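(* Let $\phi$ be an admissible potential with equilibrium state $\mu_\phi$, and assume that $\phi$ is normalized in the sense that $\sum_{a\in A}e^{\phi(ax)}=1$ for all $x\in\Omega$. Let $\phi_1(x)=\log\mu_\phi(x^0)$ and $\phi_n(x)=\log\mu_\phi(x^{n-1}|x^{0,n-2})$ for $n\ge2$, and let $\mu_{\phi_n}$ be the equilibrium state of $\phi_n$. Then there exist a constant $C>0$, for which the Gaussian concentration bound holds for $\mu_\phi$, and an integer $n_\phi\ge1$ such that, for all $n\ge n_\phi$, $$\bar d(\mu_{\phi_n},\mu_\phi)\le\rho_\phi\,\mathrm{var}_n(\phi),\qquad\text{where}\quad \rho_\phi=\sqrt{2|A|\,C}\,(e-1)\,e^{\frac32\|\phi\|_\infty}.$$
   Context: $A$ is a finite alphabet, $\mathbb{N}=\{0,1,2,\dots\}$, $\Omega=A^{\mathbb{N}}$ with points $x=x^0x^1x^2\cdots$, $x^{i,j}=x^i\cdots x^j$, and $T:\Omega\to\Omega$ is the shift $(Tx)^k=x^{k+1}$. Fix $\theta\in(0,1)$ and put $d_\theta(x,y)=\theta^{\inf\{k:\,x^k\ne y^k\}}$ (with $d_\theta(x,x)=0$). For $\phi:\Omega\to\mathbb{R}$ write $S_n\phi=\sum_{i=0}^{n-1}\phi\circ T^i$ and $\mathrm{var}_n(\phi)=\sup\{|\phi(x)-\phi(y)|: x^i=y^i,\ 0\le i\le n-1\}$. For $x,y\in\Omega$ let $W(\phi,x,y)=\sup_{n\in\mathbb{N}}\sup_{a\in A^n}|S_n\phi(ax)-S_n\phi(ay)|$,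 and for $p\in\mathbb{N}$ let $W_p(\phi)=\sup\{W(\phi,x,y): x^i=y^i,\ 0\le i\le p-1\}$. A continuous $\phi$ satisfies Walters' condition if $\sup_{x,y}W(\phi,x,y)<\infty$ and $(W_p(\phi))_{p\in\mathbb{N}}$ is strictly positive and decreases to $0$. Such a $\phi$ has a unique equilibrium state $\mu_\phi$; an equilibrium state of a potential $\psi$ is a shift-invariant probability measure maximizing $\nu\mapsto h(\nu)+\int\psi\,d\nu$, $h$ being the entropy. The measure $\mu_\phi$ has full support. ''Admissible'' means: $\phi$ is continuous, satisfies Walters' condition, and one of: (1) $W_n(\phi)=O(\theta^n)$; (2) $W_n(\phi)=O(n^{-\alpha})$ for some $\alpha>1$; (3) $W_n(\phi)=O(\eta^{(\log n)^{\alpha}})$ for some $\eta\in(0,1)$, $\alpha>1$; (4) $W_n(\phi)=O(e^{-cn^{\alpha}})$ for some $c>0$, $\alpha\in(0,1)$. A function $K:\Omega^n\to\mathbb{R}$ is separately $d_\theta$-Lipschitz if for every $i\in\{0,\dots,n-1\}$ there is a constant $\mathrm{Lip}_{\theta,i}(K)$ (taken to be the smallest one) such that $|K(x_0,\dots,x_i,\dots,x_{n-1})-K(x_0,\dots,x_i',\dots,x_{n-1})|\le \mathrm{Lip}_{\theta,i}(K)\,d_\theta(x_i,x_i')$ for all points of $\Omega$. The Gaussian concentration bound with constant $C$: for all $n\ge1$ and all separately $d_\theta$-Lipschitz $K:\Omega^n\to\mathbb{R}$, $\int e^{K(x,\dots,T^{n-1}x)}d\mu_\phi(x)\le \exp\big(\int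 K(x,\dots,T^{n-1}x)\,d\mu_\phi(x)\big)\exp\big(C\sum_{j=0}^{n-1}\mathrm{Lip}_{\theta,j}(K)^2\big)$. With $[x^{0,k-1}]=\{y\in\Omega: y^i=x^i,\ 0\le i\le k-1\}$, $\mu_\phi(x^0)=\mu_\phi([x^0])$ and $\mu_\phi(x^{n-1}|x^{0,n-2})=\mu_\phi([x^{0,n-1}])/\mu_\phi([x^{0,n-2}])$. The equilibrium state $\mu_{\phi_n}$ of $\phi_n$ is unique and is an $(n-1)$-step Markov measure. For shift-invariant probability measures $\mu,\nu$ on $\Omega$ with projections $\mu_n,\nu_n$ on $A^n$ (first $n$ coordinates), $\bar d_n(\mu_n,\nu_n)$ is the infimum of $\sum\sum\big(\sum_{i=0}^{n-1}\mathbf{1}_{\{x^i\ne y^i\}}\big)\mathbb{P}_n(x^{0,n-1},y^{0,n-1})$ over all probability distributions $\mathbb{P}_n$ on $A^n\times A^n$ with marginals $\mu_n$ and $\nu_n$, and $\bar d(\mu,\nu)=\lim_{n\to\infty}\frac1n\bar d_n(\mu_n,\nu_n)$ (the limit exists). *)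

(* Defs.v *)
From HB Require Import structures.
From mathcomp Require Import all_boot all_order all_algebra.
From mathcomp Require Import all_classical all_reals all_analysis.

Set Implicit Arguments.
Unset Strict Implicit.
Unset Printing Implicit Defensive.

Import Order.TTheory GRing.Theory Num.Theory.
Import numFieldNormedType.Exports.

Local Open Scope classical_set_scope.
Local Open Scope ring_scope.

(* The letter [a0] only witnesses that the alphabet is nonempty: measurable
   types are pointed. *)
Definition Omega (A : finType) (a0 : A) : Type := nat -> A.

HB.instance Definition _ (A : finType) (a0 : A) :=
  Topological.copy (Omega a0) {ptws nat -> discrete_topology A}.
HB.instance Definition _ (A : finType) (a0 : A) :=
  isPointed.Build (Omega a0) (fun=> a0).
HB.instance Definition _ (A : finType) (a0 : A) :=
  Measurable.copy (Omega a0) (g_sigma_algebraType (@open (Omega a0))).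

Section FullShift.
Context {A : finType} {a0 : A}.
Local Notation Omega := (Omega a0).
Implicit Types x y : Omega.

Definition left_shift x : Omega := fun k => x k.+1.

(* The default value of [nth] supplies the letters of [x] after [a]. *)
Definition concat (a : seq A) x : Omega := fun k => nth (x (k - size a)%N) a k.

Definition word (n : nat) x : n.-tuple A := [tuple x i | i < n].

Definition cylinder (n : nat) (a : n.-tuple A) : set Omega :=
  [set x | word n x = a].

Context {R : realType}.
Implicit Types (phi psi : Omega -> R) (mu nu : probability Omega R).

Definition dist (theta : R) x y : R :=
  if pselect (exists k, x k != y k) is left xy then theta ^+ ex_minn xy else 0.

Definition birkhoff_sum (n : nat) phi x : R :=
  \sum_(i < n) phi (iter i left_shift x).

(* The real suprema [var] and [sup_norm] are meaningful for bounded
   potentials, in particular for continuous ones, since Omega is compact. *)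
Definition var (n : nat) phi : R :=
  sup [set r | exists x y, word n x = word n y /\ r = `|phi x - phi y|].

Definition sup_norm phi : R := sup [set `|phi x| | x in setT].

(* These suprema may be infinite and are taken in the extended reals. *)
Definition W phi x y : \bar R :=
  ereal_sup [set r | exists (n : nat) (a : n.-tuple A),
    r = `|birkhoff_sum n phi (concat a x) -
          birkhoff_sum n phi (concat a y)|%:E].

Definition Wp (p : nat) phi : \bar R :=
  ereal_sup [set r | exists x y, word p x = word p y /\ r = W phi x y].

Definition walters phi : Prop :=
  [/\ (ereal_sup [set r | exists x y, r = W phi x y] < +oo)%E,
      forall p, (0 < Wp p phi)%E,
      {homo Wp^~ phi : p q / (p <= q)%N >-> (q <= p)%E}
    & Wp^~ phi @ \oo --> 0%E].

(* Under [walters] every [Wp n phi] is finite, so [fine] loses nothing. *)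
Definition admissible (theta : R) phi : Prop :=
  let w := fun n : nat => fine (Wp n phi) in
  [/\ continuous phi, walters phi
    & [\/ w =O_\oo (fun n : nat => theta ^+ n),
          exists2 alpha : R, 1 < alpha &
            w =O_\oo (fun n : nat => n%:R `^ (- alpha)),
          exists eta alpha : R, [/\ 0 < eta < 1, 1 < alpha &
            w =O_\oo (fun n : nat => eta `^ (ln n%:R `^ alpha))]
        | exists c alpha : R, [/\ 0 < c, 0 < alpha < 1 &
            w =O_\oo (fun n : nat => expR (- (c * n%:R `^ alpha)))]]].

Definition normalized phi : Prop :=
  forall x, \sum_(a : A) expR (phi (concat [:: a] x)) = 1.

Definition shift_invariant mu : Prop :=
  forall B, measurable B -> mu (left_shift @^-1` B) = mu B.

(* [ln 0 = 0], so null cylinders contribute 0. *)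
Definition block_entropy (n : nat) nu : R :=
  - \sum_(a : n.-tuple A)
      fine (nu (cylinder a)) * ln (fine (nu (cylinder a))).

Definition entropy nu : R :=
  lim ((fun n : nat => block_entropy n nu / n%:R) @ \oo).

Definition equilibrium_state psi mu : Prop :=
  shift_invariant mu /\
  forall nu, shift_invariant nu ->
    entropy nu + \int[nu]_x psi x <= entropy mu + \int[mu]_x psi x.

Definition is_lip_const (theta : R) (n : nat) (K : ('I_n -> Omega) -> R)
    (i : 'I_n) (L : R) : Prop :=
  0 <= L /\
  forall X X' : 'I_n -> Omega, (forall j, j != i -> X j = X' j) ->
    `|K X - K X'| <= L * dist theta (X i) (X' i).

Definition separately_lipschitz (theta : R) (n : nat)
    (K : ('I_n -> Omega) -> R) : Prop :=
  forall i, exists L, is_lip_const theta K i L.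

Definition lip_const (theta : R) (n : nat) (K : ('I_n -> Omega) -> R)
    (i : 'I_n) : R := inf [set L | is_lip_const theta K i L].

Definition gaussian_concentration (theta : R) mu (C : R) : Prop :=
  forall (n : nat) (K : ('I_n -> Omega) -> R),
    (1 <= n)%N -> separately_lipschitz theta K ->
    (\int[mu]_x (expR (K (fun i => iter i left_shift x)))%:E <=
     (expR (\int[mu]_x K (fun i => iter i left_shift x)) *
      expR (C * \sum_(j < n) lip_const theta K j ^+ 2))%:E)%E.

(* The value at 0 is a placeholder. *)
Definition markov_potential mu (n : nat) x : R :=
  match n with
  | 0 => 0
  | 1 => ln (fine (mu (cylinder (word 1 x))))
  | m.+1 => ln (fine (mu (cylinder (word m.+1 x))) /
                fine (mu (cylinder (word m x))))
  end.

Definition is_coupling (n : nat) mu nu (P : n.-tuple A -> n.-tuple A -> R)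
    : Prop :=
  [/\ forall a b, 0 <= P a b,
      forall a, \sum_(b : n.-tuple A) P a b = fine (mu (cylinder a))
    & forall b, \sum_(a : n.-tuple A) P a b = fine (nu (cylinder b))].

Definition hamming (n : nat) (a b : n.-tuple A) : nat :=
  \sum_(i < n) (tnth a i != tnth b i).

Definition dbar_n (n : nat) mu nu : R :=
  inf [set r | exists2 P, @is_coupling n mu nu P &
    r = \sum_(a : n.-tuple A) \sum_(b : n.-tuple A) (hamming a b)%:R * P a b].

Definition dbar mu nu : R :=
  lim ((fun n : nat => dbar_n n mu nu / n%:R) @ \oo).

Definition rho phi (C : R) : R :=
  Num.sqrt (2 * #|A|%:R * C) * (expR 1 - 1) * expR (3 / 2 * sup_norm phi).

End FullShift.

(* Main.v *)
(* Both bounds come from one coupling. Prepend letters to x and to y with the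
   weights exp(psi(ax)) and exp(phi(by)) of two normalized potentials, so that
   the new letters agree with probability at least 1 - gamma_k when x and y
   share their first k letters. Here gamma_k <= 1 - exp(-W_k(phi)) + eps, with
   eps = 0 if psi = phi and eps = var_n(phi) if psi is the normalized potential
   cohomologous to phi_n. In each of the four regularity classes
   S = sum_k W_k(phi) is finite, and comparison with a renewal process bounds
   the expected number of disagreements in N steps by e^S (1 + (N + 1) eps).
   For eps = var_n(phi) this yields dbar(mu_{phi_n}, mu_phi) <= e^S var_n(phi).
   For eps = 0 it bounds the oscillation of L^k f, where L is the transfer
   operator of phi and f(x) = K(x, .., T^{n-1} x), by a convolution of the
   Lipschitz constants of K with a summable sequence; Hoeffding's inequality
   for the successive steps int e^{L^k f} -> int e^{L^{k+1} f} then gives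
   Gaussian concentration with constant 2 (e^S / (1 - theta))^2. As C may be
   enlarged, it is taken so large that rho_phi >= e^S.

   That an equilibrium state mu of a normalized potential satisfies L^* mu = mu
   follows from the variational principle: stationary Markov measures show that
   the pressure is nonnegative, hence the relative entropy of mu with respect
   to the transition probabilities exp(psi) vanishes in the limit, and
   Pinsker's inequality identifies the two. *)

Require Import Defs.
From mathcomp Require Import all_boot all_order all_algebra.
From mathcomp Require Import all_classical all_reals all_analysis.
From mathcomp Require Import measurable_realfun.
From mathcomp Require Import ring lra.

Set Implicit Arguments.
Unset Strict Implicit.
Unset Printing Implicit Defensive.

Import Order.TTheory GRing.Theory Num.Theory.
Import numFieldNormedType.Exports.

Local Open Scope classical_set_scope.
Local Open Scope ring_scope.

(** * Words and the coupling operator *)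

Section WordCombinatorics.
Context {A : finType} {a0 : A}.
Local Notation Omega := (Omega a0).
Implicit Types x y : Omega.

Definition agree (m : nat) x y : Prop := forall i, (i < m)%N -> x i = y i.

Lemma word_agree m x y : word m x = word m y <-> agree m x y.
Proof.
split=> [xy i im|xy].
  by move/(congr1 (fun t => tnth t (Ordinal im))): xy; rewrite !tnth_mktuple.
by apply: eq_from_tnth => i; rewrite !tnth_mktuple xy.
Qed.

Lemma agree_le m n x y : (m <= n)%N -> agree n x y -> agree m x y.
Proof. by move=> mn xy i im; apply: xy; apply: leq_trans mn. Qed.

Lemma agree_sym m x y : agree m x y -> agree m y x.
Proof. by move=> xy i im; rewrite xy. Qed.

Lemma agree_trans m x y z : agree m x y -> agree m y z -> agree m x z.
Proof. by move=> xy yz i im; rewrite xy// yz. Qed.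

Lemma agreeS m x y : agree m.+1 x y ->
  x 0%N = y 0%N /\ agree m (left_shift x) (left_shift y).
Proof. by move=> xy; split=> [|i im]; rewrite ?/left_shift xy. Qed.

Lemma concat_cons a s x : concat (a :: s) x = concat [:: a] (concat s x).
Proof.
by apply/funext => -[|k] //=; rewrite /concat /= subSS nth_nil subn1.
Qed.

Lemma concat1_S a x k : concat [:: a] x k.+1 = x k.
Proof. by rewrite /concat /= nth_nil subn1. Qed.

Lemma left_shiftK a x : left_shift (concat [:: a] x) = x.
Proof. by apply/funext => k; rewrite /left_shift concat1_S. Qed.

Lemma concat_left_shift x : concat [:: x 0%N] (left_shift x) = x.
Proof. by apply/funext => -[|k]//; rewrite concat1_S. Qed.

Lemma agree_concat1 m a x y :
  agree m.+1 (concat [:: a] x) (concat [:: a] y) <-> agree m x y.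
Proof.
split=> [xy i im|xy [|i] im //].
  by move: (xy i.+1 im); rewrite !concat1_S.
by rewrite !concat1_S xy.
Qed.

Lemma iter_left_shift i x k : iter i left_shift x k = x (k + i)%N.
Proof.
elim: i k => [|i IH] k /=; first by rewrite addn0.
by rewrite /left_shift IH addSnnS.
Qed.

End WordCombinatorics.

Section TransferAndCoupling.
Context {R : realType} {A : finType} {a0 : A}.
Local Notation Omega := (Omega a0).
Implicit Types (x y : Omega) (psi chi f : Omega -> R) (F : Omega -> Omega -> R).

(** The Ruelle operator; for normalized [psi] it averages over one step of the chain that prepends
    letters. *)
Definition transfer psi f x : R :=
  \sum_(a : A) expR (psi (concat [:: a] x)) * f (concat [:: a] x).

(** The largest factor, at most 1, by which the [psi]-weights at [x] can be scaled while staying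
    below the [chi]-weights at [y]. *)
Definition overlap psi chi x y : R :=
  \big[Num.min/1]_(a : A) expR (chi (concat [:: a] y) - psi (concat [:: a] x)).

(* The two chains prepend the same letter [a] with weight
   [overlap * expR psi(ax)], and are otherwise coupled independently. *)
Definition coupling psi chi F x y : R :=
  overlap psi chi x y *
    \sum_(a : A) expR (psi (concat [:: a] x)) *
      F (concat [:: a] x) (concat [:: a] y) +
  \sum_(a : A) \sum_(b : A) expR (psi (concat [:: a] x)) *
    (expR (chi (concat [:: b] y)) -
     overlap psi chi x y * expR (psi (concat [:: b] x))) *
    F (concat [:: a] x) (concat [:: b] y).

Lemma transfer_ge0 psi f : (forall x, 0 <= f x) ->
  forall x, 0 <= transfer psi f x.
Proof. by move=> f0 x; apply: sumr_ge0 => a _; rewrite mulr_ge0 ?expR_ge0. Qed.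

Lemma transfer_sum psi (I : Type) (r : seq I) (P : pred I)
    (f : I -> Omega -> R) x :
  transfer psi (fun z => \sum_(i <- r | P i) f i z) x =
  \sum_(i <- r | P i) transfer psi (f i) x.
Proof.
rewrite /transfer exchange_big; apply: eq_bigr => a _.
by rewrite mulr_sumr.
Qed.

Lemma transfer_scale psi c f x :
  transfer psi (fun z => c * f z) x = c * transfer psi f x.
Proof.
rewrite /transfer mulr_sumr; apply: eq_bigr => a _.
by rewrite mulrCA.
Qed.

Lemma transfer_iter_sum psi n (I : Type) (r : seq I) (P : pred I)
    (f : I -> Omega -> R) x :
  iter n (transfer psi) (fun z => \sum_(i <- r | P i) f i z) x =
  \sum_(i <- r | P i) iter n (transfer psi) (f i) x.
Proof.
elim: n x => [//|n IH] x /=.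
rewrite -transfer_sum; congr (transfer psi _ x).
by apply/funext => z; rewrite IH.
Qed.

Lemma transfer_iter_ge0 psi n f : (forall x, 0 <= f x) ->
  forall x, 0 <= iter n (transfer psi) f x.
Proof. by move=> f0; elim: n => [//|n IH] x /=; exact: transfer_ge0. Qed.

Lemma overlap_le1 psi chi x y : overlap psi chi x y <= 1.
Proof. exact: bigmin_le_id. Qed.

Lemma overlap_ge psi chi x y c : c <= 1 ->
  (forall a, c <= expR (chi (concat [:: a] y) - psi (concat [:: a] x))) ->
  c <= overlap psi chi x y.
Proof.
move=> c1 cE; rewrite /overlap; elim/big_ind: _ => //= u v u1 v1.
by rewrite le_min u1.
Qed.

Lemma overlap_ge0 psi chi x y : 0 <= overlap psi chi x y.
Proof. by apply: overlap_ge => // a; exact: expR_ge0. Qed.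

(** Nonnegativity of the residual weights, which makes [coupling] a monotone operator. *)
Lemma overlap_weight psi chi x y b :
  overlap psi chi x y * expR (psi (concat [:: b] x)) <=
  expR (chi (concat [:: b] y)).
Proof.
have : overlap psi chi x y <=
    expR (chi (concat [:: b] y) - psi (concat [:: b] x)).
  by rewrite /overlap (bigD1 b)//= ge_min lexx.
move/(ler_wpM2r (expR_ge0 (psi (concat [:: b] x)))).
by rewrite -expRD subrK.
Qed.

Section Operator.
Variables psi chi : Omega -> R.
Hypotheses (psi1 : normalized psi) (chi1 : normalized chi).
Local Notation kappa := (coupling psi chi).

Lemma coupling_le F G : (forall x y, F x y <= G x y) ->
  forall x y, kappa F x y <= kappa G x y.
Proof.
move=> FG x y; rewrite /coupling; apply: lerD.
  apply: ler_wpM2l; first exact: overlap_ge0.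
  by apply: ler_sum => a _; apply: ler_wpM2l; rewrite ?expR_ge0.
apply: ler_sum => a _; apply: ler_sum => b _; apply: ler_wpM2l => //.
by rewrite mulr_ge0 ?expR_ge0// subr_ge0 overlap_weight.
Qed.

Lemma coupling_residual x y :
  \sum_(b : A) (expR (chi (concat [:: b] y)) -
    overlap psi chi x y * expR (psi (concat [:: b] x))) =
  1 - overlap psi chi x y.
Proof. by rewrite sumrB -mulr_sumr psi1 chi1 mulr1. Qed.

(** The residual part carries the [psi]-weights times the mass [1 - overlap], exactly what the
    common part leaves out. With [coupling_right] this says that the marginals of [coupling] are the
    two transfer operators. *)
Lemma coupling_left f x y : kappa (fun u _ => f u) x y = transfer psi f x.
Proof.
rewrite /coupling.
under [X in _ + X]eq_bigr => a _.
  rewrite -mulr_suml -mulr_sumr coupling_residual mulrAC.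
  over.
by rewrite -mulr_suml -/(transfer psi f x) mulrC -mulrDr addrC subrK mulr1.
Qed.

Lemma coupling_right f x y : kappa (fun _ v => f v) x y = transfer chi f y.
Proof.
rewrite /coupling exchange_big /=.
under [X in _ + X]eq_bigr => b _.
  rewrite -mulr_suml -mulr_suml psi1 mul1r mulrBl.
  over.
rewrite sumrB mulr_sumr addrC -/(transfer chi f y).
under [X in _ - X + _]eq_bigr do rewrite -mulrA.
by rewrite subrK.
Qed.

Lemma coupling_sum (I : Type) (r : seq I) (P : pred I)
    (F : I -> Omega -> Omega -> R) x y :
  kappa (fun u v => \sum_(i <- r | P i) F i u v) x y =
  \sum_(i <- r | P i) kappa (F i) x y.
Proof.
rewrite /coupling big_split /= -mulr_sumr; congr (_ * _ + _).
  rewrite [RHS]exchange_big; apply: eq_bigr => a _; exact: mulr_sumr.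
rewrite [RHS]exchange_big; apply: eq_bigr => a _.
rewrite [RHS]exchange_big; apply: eq_bigr => b _; exact: mulr_sumr.
Qed.

Lemma couplingZ c F x y :
  kappa (fun u v => c * F u v) x y = c * kappa F x y.
Proof.
rewrite /coupling mulrDr; congr (_ + _).
  rewrite mulrCA; congr (_ * _); rewrite mulr_sumr.
  by apply: eq_bigr => a _; rewrite mulrCA.
rewrite mulr_sumr; apply: eq_bigr => a _.
by rewrite mulr_sumr; apply: eq_bigr => b _; rewrite mulrCA.
Qed.

Lemma couplingD F G x y :
  kappa (fun u v => F u v + G u v) x y = kappa F x y + kappa G x y.
Proof.
have := coupling_sum (index_enum bool) predT
  (fun i : bool => if i then F else G) x y.
rewrite !big_bool /= => <-; congr (kappa _ x y).
by apply/funext => u; apply/funext => v; rewrite big_bool.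
Qed.

Lemma coupling_cst c x y : kappa (fun _ _ => c) x y = c.
Proof. by rewrite (coupling_left (fun=> c)) /transfer -mulr_suml psi1 mul1r. Qed.

(** Shifting undoes the prepended letter, so only the total mass 1 of the weights is left. *)
Lemma coupling_shift F x y :
  kappa (fun u v => F (left_shift u) (left_shift v)) x y = F x y.
Proof.
rewrite -[RHS](coupling_cst _ x y) /coupling.
congr (_ * _ + _); first by apply: eq_bigr => a _; rewrite !left_shiftK.
by apply: eq_bigr => a _; apply: eq_bigr => b _; rewrite !left_shiftK.
Qed.

Lemma coupling_iter_le n F G : (forall x y, F x y <= G x y) ->
  forall x y, iter n kappa F x y <= iter n kappa G x y.
Proof. by move=> FG; elim: n => [//|n IH] x y /=; exact: coupling_le. Qed.

Lemma coupling_iter_left n f x y :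
  iter n kappa (fun u _ => f u) x y = iter n (transfer psi) f x.
Proof.
elim: n x y => [//|n IH] x y /=; rewrite -(coupling_left _ x y).
by congr (kappa _ x y); apply/funext => u; apply/funext => v; rewrite IH.
Qed.

Lemma coupling_iter_right n f x y :
  iter n kappa (fun _ v => f v) x y = iter n (transfer chi) f y.
Proof.
elim: n x y => [//|n IH] x y /=; rewrite -(coupling_right _ x y).
by congr (kappa _ x y); apply/funext => u; apply/funext => v; rewrite IH.
Qed.

Lemma coupling_iter_sum n (I : Type) (r : seq I) (P : pred I)
    (F : I -> Omega -> Omega -> R) x y :
  iter n kappa (fun u v => \sum_(i <- r | P i) F i u v) x y =
  \sum_(i <- r | P i) iter n kappa (F i) x y.
Proof.
elim: n x y => [//|n IH] x y /=; rewrite -coupling_sum.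
by congr (kappa _ x y); apply/funext => u; apply/funext => v; rewrite IH.
Qed.

Lemma coupling_iterZ n c F x y :
  iter n kappa (fun u v => c * F u v) x y = c * iter n kappa F x y.
Proof.
elim: n x y => [//|n IH] x y /=; rewrite -couplingZ.
by congr (kappa _ x y); apply/funext => u; apply/funext => v; rewrite IH.
Qed.

Lemma coupling_iterD n F G x y :
  iter n kappa (fun u v => F u v + G u v) x y =
  iter n kappa F x y + iter n kappa G x y.
Proof.
elim: n x y => [//|n IH] x y /=; rewrite -couplingD.
by congr (kappa _ x y); apply/funext => u; apply/funext => v; rewrite IH.
Qed.

Lemma coupling_iter_shift n F x y :
  iter n.+1 kappa (fun u v => F (left_shift u) (left_shift v)) x y =
  iter n kappa F x y.
Proof.
rewrite iterSr; congr (iter n kappa _ x y).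
by apply/funext => u; apply/funext => v; rewrite coupling_shift.
Qed.

(** In [iter n kappa F] the function sees the sequences after all [n] letters are prepended, so [i]
    shifts remove the last [i] steps. *)
Lemma coupling_iter_shifts n i F x y : (i <= n)%N ->
  iter n kappa (fun u v => F (iter i left_shift u) (iter i left_shift v)) x y =
  iter (n - i) kappa F x y.
Proof.
elim: i n F => [|i IH] n F; first by rewrite subn0.
case: n => // n; rewrite ltnS subSS => le_in.
rewrite -IH// -[RHS]coupling_iter_shift; congr (iter n.+1 kappa _ x y).
by apply/funext => u; apply/funext => v; rewrite !iterSr.
Qed.

Definition discrepancy x y : R := (x 0%N != y 0%N)%:R.

Lemma discrepancy_le1 x y : discrepancy x y <= 1.
Proof. by rewrite /discrepancy; case: eqP. Qed.

(* [renewal gamma m k] bounds the probability that the two chains disagree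
   after [m] steps, when they start with [k] common letters and a
   disagreement occurs after [j] common letters with probability [gamma j]. *)
Fixpoint renewal (gamma : nat -> R) (m k : nat) : R :=
  match m with
  | 0 => (k == 0%N)%:R
  | m.+1 => (1 - gamma k) * renewal gamma m k.+1 + gamma k * renewal gamma m 0
  end.

Variable gamma : nat -> R.
Hypotheses (gamma01 : forall k, 0 <= gamma k <= 1)
  (gamma_dec : forall k, gamma k.+1 <= gamma k)
  (overlap_gamma : forall k x y, agree k x y -> 1 - gamma k <= overlap psi chi x y).
Local Notation U := (renewal gamma).

Lemma renewal_ge0 m k : 0 <= U m k.
Proof.
elim: m k => [|m IH] k /=; first exact: ler0n.
have /andP[g0 g1] := gamma01 k.
by rewrite addr_ge0 ?mulr_ge0// subr_ge0.
Qed.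

(** By induction on [m] the bound decreases in [k]: passing from [gamma l] to the smaller
    [gamma l.+1] moves weight from the restart, the worst state, to a state with more agreement. *)
Lemma renewal_le0 m k : U m k <= U m 0.
Proof.
suff dec j l : U j l.+1 <= U j l.
  by elim: k => // k; exact: le_trans.
elim: j l {m k} => [|j IH] l /=; first exact: ler0n.
have /andP[g0 g1] := gamma01 l; have /andP[h0 h1] := gamma01 l.+1.
have dec0 n : U j n <= U j 0 by elim: n => // n; exact: le_trans.
apply: (@le_trans _ _ ((1 - gamma l.+1) * U j l.+1 + gamma l.+1 * U j 0)).
  by rewrite lerD2r ler_wpM2l// subr_ge0.
have := dec0 l.+1; have := gamma_dec l; nra.
Qed.

(** One step either lengthens the common prefix to [k.+1] or, with probability [1 - o], falls back
    to nothing known. Since [renewal] is largest at 0, replacing [1 - o] by [gamma k] only increases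
    the bound. *)
Lemma coupling_iter_discrepancy m k x y : agree k x y ->
  iter m kappa discrepancy x y <= U m k.
Proof.
elim: m k x y => [|m IH] k x y xy /=.
  rewrite /discrepancy; case: k xy => [|k] xy; first exact: discrepancy_le1.
  by rewrite (xy 0%N)// eqxx.
rewrite [X in X <= _]/coupling.
set o := overlap _ _ x y.
have o0 : 0 <= o := overlap_ge0 _ _ _ _.
have o1 : o <= 1 := overlap_le1 _ _ _ _.
apply: (@le_trans _ _ (o * U m k.+1 + (1 - o) * U m 0)).
  apply: lerD.
    apply: ler_wpM2l => //.
    rewrite -[leRHS]mul1r -(psi1 x) mulr_suml.
    apply: ler_sum => a _; rewrite ler_wpM2l ?expR_ge0//.
    by apply: IH; apply/agree_concat1.
  rewrite -coupling_residual mulr_suml -[leRHS]mul1r -(psi1 x) mulr_suml.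
  apply: ler_sum => a _; rewrite mulr_sumr.
  apply: ler_sum => b _; rewrite mulrA ler_wpM2l//; last exact: IH.
  by rewrite mulr_ge0 ?expR_ge0// subr_ge0 overlap_weight.
have := overlap_gamma xy; rewrite -/o.
have := renewal_le0 m k.+1; have := renewal_ge0 m k.+1; nra.
Qed.

End Operator.

(** * Expected number of disagreements over many steps *)

Section RenewalSums.
Variables (gamma v : nat -> R) (eps S : R).
Hypotheses (gamma0 : forall k, 0 <= gamma k) (gamma1 : forall k, gamma k <= 1)
  (eps0 : 0 <= eps) (v0 : forall k, 0 <= v k)
  (gammav : forall k, gamma k <= 1 - expR (- v k) + eps)
  (vS : forall J, \sum_(j < J) v j <= S).

(** For [eps = 0] the exponential of minus the sum bounds from below the probability that the
    renewal process has no disagreement in [M] steps. After each disagreement the process has a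
    chance of at least [expR (- S)] of never disagreeing again, whence the factor [expR S]. The last
    term is the price of an additional [eps] at each step. *)
Lemma renewal_sum_bound M k :
  \sum_(m < M) renewal gamma m.+1 k <=
  expR S * (1 - expR (- \sum_(k <= j < k + M) v j)) + M%:R * eps * expR S.
Proof.
have suffix j l : \sum_(j <= i < j + l) v i <= S.
  apply: le_trans (vS (j + l)); rewrite -(big_mkord predT v).
  rewrite [leRHS](big_cat_nat (n := j))//= ?leq_addr// lerDr.
  exact: sumr_ge0.
elim: M k => [|M IH] k.
  by rewrite big_ord0 addn0 big_geq// oppr0 expR0 subrr !mul0r mulr0 addr0.
(* Conditioning on the first step; the summand [m = 0] contributes [renewal gamma 0 0 = 1] after a
   disagreement and 0 otherwise. *)
have -> : \sum_(m < M.+1) renewal gamma m.+1 k =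
    gamma k * (1 + \sum_(m < M) renewal gamma m.+1 0) +
    (1 - gamma k) * \sum_(m < M) renewal gamma m.+1 k.+1.
  rewrite [LHS]big_split/= -!mulr_sumr addrC; congr (_ * _ + _ * _).
    by rewrite big_ord_recl.
  by rewrite big_ord_recl/= add0r.
set E := expR (- \sum_(k <= j < k + M.+1) v j).
set E' := expR (- \sum_(k.+1 <= j < k.+1 + M) v j).
have EE' : E = expR (- v k) * E'.
  rewrite /E /E' -expRD -opprD addnS -addSn; congr (expR (- _)).
  by rewrite big_ltn// addSn ltnS leq_addr.
(* The factor [expR S] is calibrated for this: [expR S * expR (- S)] cancels the additional 1. *)
have H0 : 1 + \sum_(m < M) renewal gamma m.+1 0 <=
    expR S + M%:R * eps * expR S.
  apply: (@le_trans _ _ (1 + (expR S * (1 - expR (- S)) + M%:R * eps * expR S))).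
    rewrite lerD2l; apply: le_trans (IH 0%N) _; rewrite lerD2r.
    by rewrite ler_wpM2l ?expR_ge0// lerD2l lerN2 ler_expR lerN2 suffix.
  by rewrite addrA mulrBr mulr1 expRxMexpNx_1 [1 + _]addrC subrK.
have := IH k.+1; rewrite -/E' => H1.
have E'0 : 0 <= E' by exact: expR_ge0.
have M0 : 0 <= M%:R * eps * expR S by rewrite !mulr_ge0 ?expR_ge0.
have A0 := expR_ge0 S; have g0 := gamma0 k; have g1 := gamma1 k.
have gv := gammav k; rewrite -natr1 EE'.
set B := M%:R * eps * expR S in H0 H1 M0 *.
have -> : (M%:R + 1) * eps * expR S = B + eps * expR S by rewrite /B; ring.
set a := expR S in H0 H1 A0 *; set e := expR (- v k) in gv *.
apply: (@le_trans _ _ (gamma k * (a + B) + (1 - gamma k) * (a * (1 - E') + B))).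
  by apply: lerD; apply: ler_wpM2l; rewrite // subr_ge0.
have E'1 : E' <= 1 by rewrite -expR0 ler_expR oppr_le0 sumr_ge0.
have : 0 <= a * E' * (1 - e + eps - gamma k) by rewrite !mulr_ge0// subr_ge0.
have : a * E' * eps <= a * eps by rewrite ler_wpM2r// ler_piMr.
nra.
Qed.

Lemma renewal_sum0_bound M :
  \sum_(m < M) renewal gamma m 0 <= expR S * (1 + M%:R * eps).
Proof.
case: M => [|M].
  by rewrite big_ord0 mul0r addr0 mulr1 expR_ge0.
have -> : \sum_(m < M.+1) renewal gamma m 0 =
    1 + \sum_(m < M) renewal gamma m.+1 0 by rewrite big_ord_recl.
rewrite -natr1; apply: (@le_trans _ _
  (1 + (expR S * (1 - expR (- S)) + M%:R * eps * expR S))).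
  rewrite lerD2l; apply: le_trans (renewal_sum_bound M 0) _; rewrite lerD2r.
  rewrite ler_wpM2l ?expR_ge0// lerD2l lerN2 ler_expR lerN2.
  by rewrite add0n big_mkord.
rewrite mulrBr mulr1 expRxMexpNx_1.
have : 0 <= eps * expR S by rewrite mulr_ge0 ?expR_ge0.
nra.
Qed.

End RenewalSums.

(** * Decay of the expected distance under the coupling *)

Section Distance.
Variable theta : R.
Hypothesis theta01 : 0 < theta < 1.
Local Notation dist := (@dist A a0 R theta).

Let theta_ge0 : 0 <= theta. Proof. by case/andP: theta01 => /ltW. Qed.
Let theta_le1 : theta <= 1. Proof. by case/andP: theta01 => _ /ltW. Qed.

Lemma dist_ge0 x y : 0 <= dist x y.
Proof. by rewrite /Defs.dist; case: pselect => // xy; exact: exprn_ge0. Qed.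

Lemma dist_xx x : dist x x = 0.
Proof.
rewrite /Defs.dist; case: pselect => // ne.
by exfalso; case: ne => k; rewrite eqxx.
Qed.

Lemma dist_agree m x y : agree m x y -> dist x y <= theta ^+ m.
Proof.
move=> xy; rewrite /Defs.dist; case: pselect => [ne|_]; last exact: exprn_ge0.
case: ex_minnP => k nek _; apply: ler_wiXn2l => //.
by rewrite leqNgt; apply/negP => /xy xyk; rewrite xyk eqxx in nek.
Qed.

Lemma dist_le1 x y : dist x y <= 1.
Proof. by rewrite -[1](expr0 theta); apply: dist_agree. Qed.

Lemma dist_step x y :
  dist x y <= discrepancy x y + theta * dist (left_shift x) (left_shift y).
Proof.
rewrite /discrepancy; have [xy0|_] := eqVneq (x 0%N) (y 0%N); last first.
  apply: le_trans (dist_le1 _ _) _.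
  by rewrite lerDl mulr_ge0// dist_ge0.
rewrite add0r /Defs.dist; case: pselect => [ne|_]; last first.
  by case: pselect => ?; rewrite mulr_ge0// exprn_ge0.
case: ex_minnP => -[|k] nek mink.
  by exfalso; move: nek; rewrite xy0 eqxx.
case: pselect => [ne'|nne]; last by exfalso; apply: nne; exists k.
case: ex_minnP => l nel minl; rewrite -exprS ler_wiXn2l// ltnS.
exact: minl.
Qed.

(* [memory gamma m] bounds the expected distance after [m] coupled steps. *)
Fixpoint memory (gamma : nat -> R) (m : nat) : R :=
  match m with
  | 0 => 1
  | m.+1 => renewal gamma m.+1 0 + theta * memory gamma m
  end.

(** By [dist_step] the newest letter costs a discrepancy, and the rest is [theta] times the distance
    one step earlier. *)
Lemma coupling_iter_dist psi chi gamma m x y :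
  normalized psi -> normalized chi ->
  (forall k, 0 <= gamma k <= 1) -> (forall k, gamma k.+1 <= gamma k) ->
  (forall k x y, agree k x y -> 1 - gamma k <= overlap psi chi x y) ->
  iter m (coupling psi chi) dist x y <= memory gamma m.
Proof.
move=> psi1 chi1 g01 gd og; elim: m x y => [|m IH] x y; first exact: dist_le1.
apply: le_trans (coupling_iter_le psi chi _ dist_step x y) _.
rewrite coupling_iterD; apply: lerD.
  by apply: coupling_iter_discrepancy.
rewrite coupling_iterZ ler_wpM2l//.
by rewrite (coupling_iter_shift psi1 chi1 m dist).
Qed.

Lemma memory_ge0 gamma m : (forall k, 0 <= gamma k <= 1) -> 0 <= memory gamma m.
Proof.
move=> g01; elim: m => [|m IH]; first exact: ler01.
by rewrite addr_ge0 ?mulr_ge0// renewal_ge0.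
Qed.

(** As [memory gamma 0 = renewal gamma 0 0], the recursion bounds the sum of [memory] by [B] plus
    [theta] times itself. *)
Lemma memory_sum gamma B : (forall k, 0 <= gamma k <= 1) ->
  (forall M, \sum_(m < M) renewal gamma m 0 <= B) ->
  forall M, \sum_(m < M) memory gamma m <= B / (1 - theta).
Proof.
move=> g01 gB M; have [_ th1] := andP theta01.
rewrite ler_pdivlMr ?subr_gt0// mulrBr mulr1 lerBlDr.
case: M => [|M]; first by rewrite big_ord0 mul0r addr0; have := gB 0%N; rewrite big_ord0.
rewrite [leLHS](_ : _ =
    \sum_(m < M.+1) renewal gamma m 0 + theta * \sum_(m < M) memory gamma m).
  apply: lerD; first exact: gB.
  rewrite mulrC ler_wpM2r// [leRHS]big_ord_recr /= lerDl; exact: memory_ge0.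
by rewrite big_ord_recl [in RHS]big_ord_recl -addrA mulr_sumr -big_split.
Qed.

End Distance.

End TransferAndCoupling.

(** * Cylinders and integrals of uniformly continuous functions *)

Section Cylinders.
Context {R : realType} {A : finType} {a0 : A}.
Local Notation Omega := (Omega a0).
Implicit Types (x y : Omega) (s t : seq A).

(** Words are lists here, not tuples, so that a letter can be added at either end without a cast. *)
Definition cyl s : set Omega := [set x | mkseq x (size s) = s].

Lemma cylinderE n (a : n.-tuple A) : @cylinder A a0 n a = cyl a.
Proof.
apply/seteqP; split=> x /=; rewrite /cyl /=.
  by move=> <-; rewrite size_tuple /mkseq -val_enum_ord -map_comp.
rewrite size_tuple => xa; apply: val_inj => /=.
by rewrite -[RHS]xa /mkseq -val_enum_ord -map_comp.
Qed.

Lemma mkseq_agree n x y : mkseq x n = mkseq y n <-> agree n x y.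
Proof.
split=> [xy i im|xy].
  by move/(congr1 (fun s => nth a0 s i)): xy; rewrite !nth_mkseq.
by apply/eq_in_map => i; rewrite mem_iota => /andP[_] /xy.
Qed.

Lemma agree_concat_mkseq n x y : agree n x (concat (mkseq x n) y).
Proof. by move=> i im; rewrite /concat nth_mkseq. Qed.

Lemma cyl_agree s x y : cyl s x -> agree (size s) x y -> cyl s y.
Proof. by rewrite /cyl /= => xs /mkseq_agree xy; rewrite -xy. Qed.

Lemma cyl_nil : cyl [::] = setT.
Proof. by apply/seteqP; split. Qed.

Lemma cyl_cons a s x : cyl (a :: s) x <-> x 0%N = a /\ cyl s (left_shift x).
Proof.
rewrite /cyl /= /mkseq /= -[1%N]addn0 iotaDl -map_comp.
by split=> [[-> h]|[-> h]]; [split|congr cons].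
Qed.

Lemma cyl_rcons a s x : cyl (rcons s a) x <-> cyl s x /\ x (size s) = a.
Proof.
rewrite /cyl /= size_rcons /mkseq -addn1 iotaD map_cat /= add0n cats1.
by split=> [/rcons_inj[-> ->]//|[-> ->]].
Qed.

(** The sets of points sharing a prefix with [x] generate a filter; it converges to [x] in the
    product topology because it does so in each coordinate. *)
Lemma nbhs_agree x (U : set Omega) :
  nbhs x U -> exists n, forall y, agree n x y -> U y.
Proof.
pose F := filter_from setT (fun n => [set y | agree n x y]).
have FF : Filter F.
  apply: filter_from_filter; first by exists 0%N.
  move=> i j _ _; exists (maxn i j) => // y xy.
  by split; apply: agree_le xy; rewrite ?leq_maxl ?leq_maxr.
suff Fx : F --> (x : {ptws nat -> discrete_topology A}).
  by move/Fx => [n _ nU]; exists n.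
have := @cvg_sup (forall _ : nat, discrete_topology A) nat
  (fun i => Topological.class (initial_topology
     (fun f : (forall _ : nat, discrete_topology A) => f i))) F x FF.
move=> [_]; apply => k.
have [|_ Fk] := @cvg_image (forall _ : nat, discrete_topology A)
  (discrete_topology A) (fun f => f k) F x FF.
  by apply/seteqP; split=> // a _; exists (fun=> a).
refine (Fk _).
move=> V /= Vxk; exists [set y : Omega | V (y k)]; last first.
  apply/seteqP; split=> [_ [y Vy <-]//|a Va].
  by exists (fun=> a).
exists k.+1 => // y xy /=; rewrite -(xy k)//.
exact: (@nbhs_singleton (discrete_topology A) (x k) V Vxk).
Qed.

Lemma agree_nbhs x n : nbhs x [set y | agree n x y].
Proof.
elim: n => [|n IH]; first by apply: filterS filterT.
have : nbhs x [set y : Omega | y n = x n].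
  have /= := @proj_continuous nat (fun=> discrete_topology A) n x
    [set a | a = x n]; apply.
  exact: discrete_set1.
move=> h; apply: filterS2 IH h => y xy xyn i.
by rewrite ltnS leq_eqVlt => /predU1P[->|/xy].
Qed.

Lemma open_cyl s : open (cyl s).
Proof.
rewrite openE => x xs; apply: filterS (agree_nbhs x (size s)) => y.
exact: cyl_agree.
Qed.

Lemma measurable_cyl s : measurable (cyl s).
Proof. by apply: sub_sigma_algebra; exact: open_cyl. Qed.

(** An open set is the union of the cylinders inside it, and there are only countably many words. *)
Lemma measurable_cylE :
  @measurable _ Omega = <<s [set B | B = set0 \/ exists s, B = cyl s] >>.
Proof.
apply/seteqP; split; last first.
  apply: smallest_sub; first exact: sigma_algebra_measurable.
  by move=> B [->|[s ->]]; [exact: measurable0|exact: measurable_cyl].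
apply: smallest_sub; first exact: smallest_sigma_algebra.
move=> U oU.
set G := [set B | _].
have -> : U = \bigcup_(s in [set s | cyl s `<=` U]) cyl s.
  apply/seteqP; split=> [x Ux|x [s /= sU /sU]//].
  have := open_nbhs_nbhs (conj oU Ux) => /nbhs_agree[n nU].
  exists (mkseq x n); last by rewrite /cyl /= size_mkseq.
  move=> y; rewrite /cyl /= size_mkseq => /mkseq_agree yx.
  by apply: nU; exact: agree_sym.
rewrite bigcup_mkcond.
have := @countable_bigcupT_measurable _ (g_sigma_algebraType G) (seq A).
move=> /(_ (fun s => if s \in [set s | cyl s `<=` U] then cyl s else set0)).
apply; first exact: countableP.
move=> s; case: ifP => _; last exact: measurable0.
by apply: sub_sigma_algebra; right; exists s.
Qed.

(** Of two words, either one is a prefix of the other or their cylinders are disjoint. *)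
Lemma setI_closed_cyl :
  setI_closed [set B : set Omega | B = set0 \/ exists s, B = cyl s].
Proof.
move=> B C [->|[s ->]]; first by left; rewrite set0I.
move=> [->|[t ->]]; first by left; rewrite setI0.
wlog st : s t / (size s <= size t)%N.
  move=> h; have [|/ltnW] := leqP (size s) (size t); first exact: h.
  by rewrite setIC; exact: h.
have [E|nE] := eqVneq (take (size s) t) s.
  right; exists t; apply: setIidr => x; rewrite /cyl /= => xt.
  by rewrite -{2}E -xt -map_take take_iota (minn_idPl st).
left; rewrite -subset0 => x [/= xs xt]; move/eqP: nE; apply.
by rewrite -xt -map_take take_iota (minn_idPl st).
Qed.

Lemma measurable_fun_cyl d (T : measurableType d) (f : T -> Omega) :
  (forall s, measurable (f @^-1` cyl s)) -> measurable_fun setT f.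
Proof.
move=> mf; apply: (measurability _ measurable_cylE) => _ [B [->|[s ->]] <-].
  by rewrite preimage_set0 setI0; exact: measurable0.
by rewrite setTI; exact: mf.
Qed.

Lemma measurable_left_shift : measurable_fun setT (left_shift : Omega -> Omega).
Proof.
apply: measurable_fun_cyl => s.
have -> : left_shift @^-1` cyl s = \big[setU/set0]_(a : A) cyl (a :: s).
  rewrite -bigcup_seq; apply/seteqP; split=> x /=.
    by move=> xs; exists (x 0%N) => //=; [rewrite mem_index_enum|apply/cyl_cons].
  by move=> [a _ /cyl_cons[_]].
by apply: bigsetU_measurable => a _; exact: measurable_cyl.
Qed.

Lemma probability_cyl_unique (P Q : probability Omega R) :
  (forall s, P (cyl s) = Q (cyl s)) ->
  forall B, measurable B -> P B = Q B.
Proof.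
move=> PQ; apply: (measure_unique _ (fun=> setT) measurable_cylE) => //.
- exact: setI_closed_cyl.
- by move=> _; right; exists [::]; rewrite cyl_nil.
- by rewrite bigcup_const.
- move=> _ [->|[s ->]]; last exact: PQ.
  by rewrite (measure0 P) (measure0 Q).
- by move=> _; apply: le_lt_trans (probability_le1 P measurableT) (ltry 1).
Qed.

End Cylinders.

Section WordSums.
Context {R : realType} {A : finType}.
Implicit Types (F G : seq A -> R).

Definition wsum n F : R := \sum_(a : n.-tuple A) F a.

Lemma eq_wsum n F G : (forall s, size s = n -> F s = G s) ->
  wsum n F = wsum n G.
Proof. by move=> FG; apply: eq_bigr => a _; apply: FG; rewrite size_tuple. Qed.

Lemma le_wsum n F G : (forall s, size s = n -> F s <= G s) ->
  wsum n F <= wsum n G.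
Proof. by move=> FG; apply: ler_sum => a _; apply: FG; rewrite size_tuple. Qed.

Lemma wsum_ge0 n F : (forall s, size s = n -> 0 <= F s) -> 0 <= wsum n F.
Proof. by move=> F0; apply: sumr_ge0 => a _; apply: F0; rewrite size_tuple. Qed.

Lemma wsum_le0 n F : (forall s, size s = n -> F s <= 0) -> wsum n F <= 0.
Proof. by move=> F0; apply: sumr_le0 => a _; apply: F0; rewrite size_tuple. Qed.

Lemma wsum0 F : wsum 0 F = F [::].
Proof.
rewrite /wsum (bigD1 [tuple])//= big1 ?addr0// => a /negP[].
exact/eqP/tuple0.
Qed.

Lemma wsumD n F G : wsum n (fun s => F s + G s) = wsum n F + wsum n G.
Proof. exact: big_split. Qed.

Lemma wsumB n F G : wsum n (fun s => F s - G s) = wsum n F - wsum n G.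
Proof. exact: sumrB. Qed.

Lemma wsumN n F : wsum n (fun s => - F s) = - wsum n F.
Proof. exact: sumrN. Qed.

Lemma wsumZ n c F : wsum n (fun s => c * F s) = c * wsum n F.
Proof. by rewrite /wsum mulr_sumr. Qed.

Lemma wsum_exchange n (F : A -> seq A -> R) :
  wsum n (fun s => \sum_(a : A) F a s) = \sum_(a : A) wsum n (F a).
Proof. exact: exchange_big. Qed.

Lemma wsum_cons n F :
  wsum n.+1 F = \sum_(a : A) wsum n (fun s => F (a :: s)).
Proof.
rewrite /wsum pair_big /=.
rewrite (reindex (fun p : A * n.-tuple A => cons_tuple p.1 p.2)) //=.
exists (fun t : n.+1.-tuple A => (thead t, behead_tuple t)) => [[a t] _|t _] /=.
  by congr pair; apply: val_inj.
by case/tupleP: t => a t; apply: val_inj.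
Qed.

Lemma wsum_rcons n F :
  wsum n.+1 F = \sum_(a : A) wsum n (fun s => F (rcons s a)).
Proof.
elim: n F => [|n IH] F.
  by rewrite wsum_cons; apply: eq_bigr => a _; rewrite !wsum0.
rewrite wsum_cons.
under eq_bigr do rewrite IH.
by rewrite exchange_big; apply: eq_bigr => a _; rewrite wsum_cons.
Qed.

Lemma wsum_mkseq (x : nat -> A) n F : wsum n (fun s => (mkseq x n == s)%:R * F s) =
  F (mkseq x n).
Proof.
rewrite /wsum (bigD1 (Tuple (introT eqP (size_mkseq x n))))//= eqxx mul1r.
rewrite big1 ?addr0// => a; rewrite eq_sym -val_eqE /= => /negbTE ->.
by rewrite mul0r.
Qed.

End WordSums.

(** * Uniformly continuous functions on the shift space and their closure properties *)

Section UniformContinuity.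
Context {R : realType} {A : finType} {a0 : A}.
Local Notation Omega := (Omega a0).
Implicit Types (x y : Omega) (f g : Omega -> R) (s : seq A).

(** Uniform continuity for [dist], expressed by common prefixes; [walters] supplies such a modulus
    directly. *)
Definition ucont f : Prop := forall e : R, 0 < e ->
  exists m, forall x y, agree m x y -> `|f x - f y| <= e.

Definition depends_on m f : Prop := forall x y, agree m x y -> f x = f y.

Lemma ucont_depends_on m f : depends_on m f -> ucont f.
Proof.
by move=> fm e e0; exists m => x y /fm ->; rewrite subrr normr0 ltW.
Qed.

Lemma depends_on_transfer psi k m f : depends_on k.+1 psi ->
  depends_on (k + m).+1 f -> depends_on (k + m) (transfer psi f).
Proof.
move=> kpsi mf x y xy; apply: eq_bigr => a _; congr (expR _ * _).
  by apply: kpsi; apply/agree_concat1; apply: agree_le xy; exact: leq_addr.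
by apply: mf; apply/agree_concat1.
Qed.

(** Each prepended letter takes over one coordinate of [f], until only the [k] coordinates read by
    [psi] remain. *)
Lemma depends_on_transfer_iter psi k m f : depends_on k.+1 psi ->
  depends_on (k + m) f -> depends_on k (iter m (transfer psi) f).
Proof.
move=> kpsi; elim: m f => [|m IH] f; first by rewrite addn0.
by rewrite addnS iterSr => mf; apply: IH; exact: depends_on_transfer.
Qed.

Lemma ucont_cst c : ucont (fun=> c).
Proof. exact: (@ucont_depends_on 0). Qed.

Lemma ucontD f g : ucont f -> ucont g -> ucont (fun x => f x + g x).
Proof.
move=> uf ug e e0; have e20 : 0 < e / 2 by rewrite divr_gt0.
have [m fm] := uf _ e20; have [n gn] := ug _ e20.
exists (maxn m n) => x y xy.
have := fm x y (agree_le (leq_maxl _ _) xy).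
have := gn x y (agree_le (leq_maxr _ _) xy).
by rewrite !ler_norml => /andP[? ?] /andP[? ?]; apply/andP; split; lra.
Qed.

Lemma ucont_sum (I : Type) (r : seq I) (P : pred I) (f : I -> Omega -> R) :
  (forall i, P i -> ucont (f i)) -> ucont (fun x => \sum_(i <- r | P i) f i x).
Proof.
move=> uf; elim: r => [|i r IH].
  by have := ucont_cst 0; congr ucont; apply/funext => x; rewrite big_nil.
have [Pi|nPi] := boolP (P i); last first.
  by move: IH; congr ucont; apply/funext => x; rewrite big_cons (negbTE nPi).
have := ucontD (uf i Pi) IH; congr ucont.
by apply/funext => x; rewrite big_cons Pi.
Qed.

Lemma ucont_bounded f : ucont f -> exists2 M, 0 < M & forall x, `|f x| <= M.
Proof.
(* [F] gives the absolute values of [f] at representatives of the finitely many cylinders of length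
   [m]; their sum bounds them all at once. *)
move=> /(_ _ ltr01)[m fm]; pose F s := `|f (concat s (fun=> a0))|.
have F0 s : 0 <= F s by exact: normr_ge0.
exists (1 + wsum m F).
  by rewrite ltr_pwDl// wsum_ge0.
move=> x; set y : Omega := concat (mkseq x m) (fun=> a0).
have xy : agree m x y.
  exact: agree_concat_mkseq.
rewrite -[f x](subrK (f y)); apply: le_trans (ler_normD _ _) _.
apply: lerD; first exact: fm.
rewrite /wsum (bigD1 (Tuple (introT eqP (size_mkseq x m))))//=.
by rewrite lerDl; apply: sumr_ge0 => a _; exact: F0.
Qed.

Lemma ucontM f g : ucont f -> ucont g -> ucont (fun x => f x * g x).
Proof.
move=> uf ug e e0.
have [M M0 fM] := ucont_bounded uf; have [N N0 gN] := ucont_bounded ug.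
have [|m fm] := uf (e / (2 * N)); first by rewrite divr_gt0// mulr_gt0.
have [|n gn] := ug (e / (2 * M)); first by rewrite divr_gt0// mulr_gt0.
exists (maxn m n) => x y xy.
have -> : f x * g x - f y * g y = (f x - f y) * g x + f y * (g x - g y) by ring.
apply: le_trans (ler_normD _ _) _; rewrite !normrM.
have -> : e = (e / (2 * N)) * N + M * (e / (2 * M)).
  by field; rewrite !gt_eqF.
apply: lerD; apply: ler_pM => //.
  by apply: fm; apply: agree_le xy; exact: leq_maxl.
by apply: gn; apply: agree_le xy; exact: leq_maxr.
Qed.

Lemma ucontN f : ucont f -> ucont (fun x => - f x).
Proof.
move=> uf; have := ucontM (ucont_cst (- 1)) uf; congr ucont.
by apply/funext => x; rewrite mulN1r.
Qed.

Lemma ucontB f g : ucont f -> ucont g -> ucont (fun x => f x - g x).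
Proof. by move=> uf /ucontN; exact: ucontD. Qed.

Lemma expR_lipschitz (M s t : R) : s <= M -> t <= M ->
  `|expR s - expR t| <= expR M * `|s - t|.
Proof.
wlog ts : s t / t <= s => [h sM tM|sM _].
  have [/h|/ltW/h] := leP t s; first exact.
  by rewrite distrC (distrC s); exact.
rewrite !ger0_norm ?subr_ge0 ?ler_expR//.
have -> : expR s - expR t = expR s * (1 - expR (t - s)).
  by rewrite mulrBr mulr1 -expRD [s + _]addrC subrK.
apply: ler_pM; rewrite ?expR_ge0 ?ler_expR//.
  by rewrite subr_ge0 -expR0 ler_expR subr_le0.
have := expR_ge1Dx (t - s); lra.
Qed.

Lemma ucont_expR f : ucont f -> ucont (fun x => expR (f x)).
Proof.
move=> uf e e0; have [M M0 fM] := ucont_bounded uf.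
have [|m fm] := uf (e / expR M); first by rewrite divr_gt0// expR_gt0.
exists m => x y xy.
apply: (@le_trans _ _ (expR M * `|f x - f y|)).
  by apply: expR_lipschitz; apply: le_trans (ler_norm _) (fM _).
by rewrite mulrC -ler_pdivlMr ?expR_gt0// fm.
Qed.

Lemma ucont_min f g : ucont f -> ucont g -> ucont (fun x => Num.min (f x) (g x)).
Proof.
move=> uf ug e e0.
have [m fm] := uf _ e0; have [n gn] := ug _ e0.
exists (maxn m n) => x y xy.
have := fm x y (agree_le (leq_maxl _ _) xy).
have := gn x y (agree_le (leq_maxr _ _) xy).
rewrite !ler_norml => /andP[? ?] /andP[? ?].
by case: (leP (f x)); case: (leP (f y)) => ? ?; apply/andP; split; lra.
Qed.

Lemma ucont_concat1 a f : ucont f -> ucont (fun x => f (concat [:: a] x)).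
Proof.
move=> uf e /uf[m fm]; exists m => x y xy; apply: fm.
by apply: (agree_le (leqnSn m)); apply/agree_concat1.
Qed.

Lemma ucont_overlap psi chi x : ucont chi -> ucont (overlap psi chi x).
Proof.
move=> uchi; pose g a y := expR (chi (concat [:: a] y) - psi (concat [:: a] x)).
suff h (r : seq A) : ucont (fun y => \big[Num.min/1]_(a <- r) g a y) by exact: h.
elim: r => [|a r IH].
  by have := ucont_cst 1; congr ucont; apply/funext => y; rewrite big_nil.
have ug : ucont (g a).
  apply/ucont_expR/ucontB; last exact: ucont_cst.
  exact: (@ucont_concat1 a chi).
have := ucont_min ug IH; congr ucont; apply/funext => y.
by rewrite big_cons.
Qed.

Lemma ucont_coupling psi chi F x : ucont chi -> (forall u, ucont (F u)) ->
  ucont (coupling psi chi F x).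
Proof.
move=> uchi uF; apply: ucontD.
  apply: ucontM; first exact: ucont_overlap.
  apply: ucont_sum => a _; apply: ucontM; first exact: ucont_cst.
  exact: (@ucont_concat1 a (F _)).
apply: ucont_sum => a _; apply: ucont_sum => b _; apply: ucontM.
  apply: ucontM; first exact: ucont_cst.
  apply: ucontB; first exact/ucont_expR/(@ucont_concat1 b chi).
  apply: ucontM; last exact: ucont_cst.
  exact: ucont_overlap.
exact: (@ucont_concat1 b (F _)).
Qed.

Lemma ucont_coupling_iter n psi chi F x : ucont chi -> (forall u, ucont (F u)) ->
  ucont (iter n (coupling psi chi) F x).
Proof.
by move=> uchi uF; elim: n x => [//|n IH] x; exact: ucont_coupling.
Qed.

Lemma ucont_left_shift f : ucont f -> ucont (fun x => f (left_shift x)).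
Proof.
by move=> uf e /uf[m fm]; exists m.+1 => x y /agreeS[_ xy]; apply: fm.
Qed.

Lemma ucont_transfer psi f : ucont psi -> ucont f -> ucont (transfer psi f).
Proof.
move=> up uf; apply: ucont_sum => a _.
apply: ucontM; last exact: ucont_concat1.
exact/ucont_expR/(@ucont_concat1 a psi).
Qed.

Lemma ucont_transfer_iter psi f n :
  ucont psi -> ucont f -> ucont (iter n (transfer psi) f).
Proof. by move=> up uf; elim: n => [//|n IH] /=; exact: ucont_transfer. Qed.

Lemma ucont_mkseq n (F : seq A -> R) : ucont (fun x => F (mkseq x n)).
Proof. by apply: (@ucont_depends_on n) => x y /mkseq_agree ->. Qed.

Lemma ucont_measurable f : ucont f -> measurable_fun setT f.
Proof.
move=> uf; apply: (measurability _ (RGenOpens.measurableE R)).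
move=> _ [_ [a [b ->] <-]]; rewrite setTI; apply: sub_sigma_algebra.
rewrite /= openE => x /=; rewrite in_itv /= => /andP[ax xb].
have [|m fm] := uf (Num.min ((f x - a) / 2) ((b - f x) / 2)).
  by rewrite lt_min !divr_gt0// subr_gt0.
apply: filterS (agree_nbhs x m) => y /= /fm.
rewrite le_min !ler_norml in_itv /= => /andP[/andP[? ?] /andP[? ?]].
by apply/andP; split; lra.
Qed.

Lemma ucont_integrable (mu : probability Omega R) f :
  ucont f -> mu.-integrable setT (EFin \o f).
Proof.
move=> uf; apply: measurable_bounded_integrable => //.
- exact: le_lt_trans (probability_le1 mu measurableT) (ltry 1).
- exact: ucont_measurable.
- have [M _ fM] := ucont_bounded uf.
  exists M; split; first exact: num_real.
  by move=> N MN x _ /=; apply: le_trans (fM x) (ltW MN).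
Qed.

End UniformContinuity.

(** * Word probabilities and integrals against a probability measure *)

Section Integrals.
Context {R : realType} {A : finType} {a0 : A}.
Local Notation Omega := (Omega a0).
Variable mu : probability Omega R.
Implicit Types (x y : Omega) (f g : Omega -> R) (s : seq A).

Definition prob s : R := fine (mu (cyl s)).

Lemma prob_EFin s : mu (cyl s) = (prob s)%:E.
Proof.
rewrite /prob fineK// ge0_fin_numE//.
exact: le_lt_trans (probability_le1 mu (measurable_cyl s)) (ltry 1).
Qed.

Lemma prob_ge0 s : 0 <= prob s.
Proof. by rewrite -lee_fin -prob_EFin. Qed.

Lemma prob_nil : prob [::] = 1.
Proof. by rewrite /prob cyl_nil probability_setT. Qed.

Lemma Rint_cst c : \int[mu]_x (cst c) x = c.
Proof. by rewrite Rintegral_cst//= probability_setT mulr1. Qed.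

Lemma le_Rint f g : ucont f -> ucont g -> (forall x, f x <= g x) ->
  \int[mu]_x f x <= \int[mu]_x g x.
Proof. by move=> uf ug fg; apply: le_Rintegral => //; exact: ucont_integrable. Qed.

Lemma Rint_bound f c : ucont f -> (forall x, `|f x| <= c) ->
  `|\int[mu]_x f x| <= c.
Proof.
move=> uf fc; rewrite ler_norml; apply/andP; split.
  rewrite -[leLHS]Rint_cst; apply: le_Rint => //; first exact: ucont_cst.
  by move=> x; have := fc x; rewrite ler_norml => /andP[].
rewrite -[leRHS]Rint_cst; apply: le_Rint => //; first exact: ucont_cst.
by move=> x; have := fc x; rewrite ler_norml => /andP[].
Qed.

Lemma RintD f g : ucont f -> ucont g ->
  \int[mu]_x (f x + g x) = \int[mu]_x f x + \int[mu]_x g x.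
Proof. by move=> uf ug; apply: RintegralD => //; exact: ucont_integrable. Qed.

Lemma RintB f g : ucont f -> ucont g ->
  \int[mu]_x (f x - g x) = \int[mu]_x f x - \int[mu]_x g x.
Proof. by move=> uf ug; apply: RintegralB => //; exact: ucont_integrable. Qed.

Lemma RintZ c f : ucont f -> \int[mu]_x (c * f x) = c * \int[mu]_x f x.
Proof. by move=> uf; apply: RintegralZl => //; exact: ucont_integrable. Qed.

Lemma Rint_sum (I : Type) (r : seq I) (P : pred I) (f : I -> Omega -> R) :
  (forall i, P i -> ucont (f i)) ->
  \int[mu]_x (\sum_(i <- r | P i) f i x) =
  \sum_(i <- r | P i) \int[mu]_x f i x.
Proof.
move=> uf; elim: r => [|i r IH].
  rewrite big_nil -[RHS]Rint_cst; apply: eq_Rintegral => x _.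
  by rewrite big_nil.
rewrite big_cons -IH; case: ifPn => Pi; last first.
  by apply: eq_Rintegral => x _; rewrite big_cons (negbTE Pi).
rewrite -(RintD (uf i Pi) (ucont_sum r uf)).
by apply: eq_Rintegral => x _; rewrite big_cons Pi.
Qed.

Lemma Rint_cyl s : \int[mu]_x (mkseq x (size s) == s)%:R = prob s.
Proof.
have -> : prob s = \int[mu]_x \1_(cyl s) x.
  by rewrite /Rintegral integral_indic ?setIT//; exact: measurable_cyl.
apply: eq_Rintegral => x _; rewrite indicE; congr ((nat_of_bool _)%:R).
by apply/eqP/idP => [?|/set_mem//]; rewrite inE.
Qed.

Lemma Rint_word m (F : seq A -> R) :
  \int[mu]_x F (mkseq x m) = wsum m (fun s => prob s * F s).
Proof.
transitivity (\int[mu]_x wsum m (fun s => (mkseq x m == s)%:R * F s)).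
  by apply: eq_Rintegral => x _; rewrite wsum_mkseq.
rewrite Rint_sum => [|a _]; last exact: (ucont_mkseq m (fun t => (t == a)%:R * F a)).
apply: eq_bigr => a _; rewrite -Rint_cyl mulrC -RintZ.
  by apply: eq_Rintegral => x _; rewrite size_tuple mulrC.
exact: (ucont_mkseq _ (fun t => (t == a)%:R)).
Qed.

Lemma Rint_approx m e f : ucont f ->
  (forall x y, agree m x y -> `|f x - f y| <= e) -> forall z,
  `|\int[mu]_x f x - wsum m (fun s => prob s * f (concat s z))| <= e.
Proof.
move=> uf fm z; rewrite -(Rint_word m (fun s => f (concat s z))) -RintB//.
  apply: Rint_bound; first by apply: ucontB => //; exact: (ucont_mkseq m (fun s => f (concat s z))).
  by move=> x; exact/fm/agree_concat_mkseq.
exact: (ucont_mkseq m (fun s => f (concat s z))).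
Qed.

Lemma Rint_depends_on m f z : depends_on m f ->
  \int[mu]_x f x = wsum m (fun s => prob s * f (concat s z)).
Proof.
move=> mf; rewrite -(Rint_word m (fun s => f (concat s z))).
by apply: eq_Rintegral => x _; exact/mf/agree_concat_mkseq.
Qed.

Lemma prob_rcons s : prob s = \sum_(a : A) prob (rcons s a).
Proof.
rewrite -Rint_cyl; under [RHS]eq_bigr do rewrite -Rint_cyl.
rewrite -Rint_sum => [|a _]; last exact: (ucont_mkseq _ (fun t => (t == rcons s a)%:R)).
apply: eq_Rintegral => x _; rewrite (bigD1 (x (size s)))//= big1 => [|a ax].
  rewrite addr0 size_rcons; congr ((nat_of_bool _)%:R).
  apply/eqP/eqP => [xs|xs]; last by have /cyl_rcons[] : cyl (rcons s (x (size s))) x by rewrite /cyl /= size_rcons.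
  have : cyl (rcons s (x (size s))) x by apply/cyl_rcons.
  by rewrite /cyl /= size_rcons.
case: eqP => // xs; suff /cyl_rcons[_ /eqP] : cyl (rcons s a) x by rewrite eq_sym (negbTE ax).
exact: xs.
Qed.

Lemma wsum_prob m : wsum m prob = 1.
Proof.
rewrite -[RHS]Rint_cst (Rint_word m (fun=> 1)).
by apply: eq_wsum => s _; rewrite mulr1.
Qed.

Lemma prob_rcons_le s a : prob (rcons s a) <= prob s.
Proof.
rewrite (prob_rcons s) (bigD1 a)//= lerDl.
by apply: sumr_ge0 => b _; exact: prob_ge0.
Qed.

Lemma prob_left_shift s :
  fine (mu (left_shift @^-1` cyl s)) = \sum_(a : A) prob (a :: s).
Proof.
have -> : fine (mu (left_shift @^-1` cyl s)) =
    \int[mu]_x (mkseq (left_shift x) (size s) == s)%:R.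
  have -> : fine (mu (left_shift @^-1` cyl s)) =
      \int[mu]_x \1_(left_shift @^-1` cyl s) x.
    rewrite /Rintegral integral_indic ?setIT//.
    by rewrite -[X in measurable X]setTI; apply: measurable_left_shift => //;
       exact: measurable_cyl.
  apply: eq_Rintegral => x _; rewrite indicE; congr ((nat_of_bool _)%:R).
  by apply/idP/eqP => [/set_mem//|?]; rewrite inE.
under [RHS]eq_bigr do rewrite -Rint_cyl.
rewrite -Rint_sum => [|a _]; last exact: (ucont_mkseq _ (fun t => (t == a :: s)%:R)).
apply: eq_Rintegral => x _; rewrite (bigD1 (x 0%N))//= big1 => [|a ax].
  rewrite addr0; congr ((nat_of_bool _)%:R); apply/eqP/eqP => xs.
    by have /cyl_cons : x 0%N = x 0%N /\ cyl s (left_shift x) by [].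
  by have /cyl_cons[] : cyl (x 0%N :: s) x by [].
case: eqP => // xs; suff /cyl_cons[/eqP] : cyl (a :: s) x by rewrite eq_sym (negbTE ax).
exact: xs.
Qed.

Section Invariance.
Hypothesis mu_inv : shift_invariant mu.

Lemma prob_cons s : prob s = \sum_(a : A) prob (a :: s).
Proof. by rewrite -prob_left_shift mu_inv//; exact: measurable_cyl. Qed.

Lemma prob_cons_le s a : prob (a :: s) <= prob s.
Proof.
rewrite (prob_cons s) (bigD1 a)//= lerDl.
by apply: sumr_ge0 => b _; exact: prob_ge0.
Qed.

Lemma Rint_left_shift f : ucont f ->
  \int[mu]_x f (left_shift x) = \int[mu]_x f x.
Proof.
move=> uf; apply/eqP; rewrite -subr_eq0 -normr_le0; apply/ler_addgt0Pr => e e0.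
rewrite add0r; have [|m fm] := uf (e / 2); first by rewrite divr_gt0.
have h1 := Rint_approx uf fm (fun=> a0).
have h2 : `|\int[mu]_x f (left_shift x) -
    wsum m.+1 (fun s => prob s * f (left_shift (concat s (fun=> a0))))| <= e / 2.
  apply: (@Rint_approx m.+1 _ (fun x => f (left_shift x))).
    exact: ucont_left_shift.
  by move=> x y /agreeS[_ xy]; apply: fm.
have E : wsum m.+1 (fun s => prob s * f (left_shift (concat s (fun=> a0)))) =
    wsum m (fun s => prob s * f (concat s (fun=> a0))).
  rewrite wsum_cons -wsum_exchange; apply: eq_wsum => s _.
  rewrite (prob_cons s) mulr_suml; apply: eq_bigr => a _.
  by rewrite concat_cons left_shiftK.
rewrite E in h2; move: h1 h2; rewrite !ler_norml => /andP[? ?] /andP[? ?].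
by apply/andP; split; lra.
Qed.

End Invariance.
End Integrals.

(** * Entropy *)

Section Gibbs.
Context {R : realType}.
Implicit Types p q eta : R.

(** This is [ln t <= t - 1] at the ratio [t] of the square roots of [q] and [p], multiplied by
    [- 2 * p]. Absolute continuity must be assumed, as [ln 0 = 0]. *)
Lemma gibbs_sqrt p q : 0 <= p -> 0 <= q -> (q = 0 -> p = 0) ->
  (Num.sqrt p - Num.sqrt q) ^+ 2 <= p * (ln p - ln q) - p + q.
Proof.
move=> p0 q0 pq.
have [->|pn0] := eqVneq p 0.
  by rewrite sqrtr0 sub0r sqrrN sqr_sqrtr// mul0r subrr add0r.
have qn0 : q != 0 by apply: contra_neq pn0.
have pp : 0 < p by rewrite lt0r pn0.
have qp : 0 < q by rewrite lt0r qn0.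
have := sqr_sqrtr p0; have := sqr_sqrtr q0.
set a := Num.sqrt p; set b := Num.sqrt q => bq ap.
have a0 : 0 < a by rewrite sqrtr_gt0.
have b0 : 0 < b by rewrite sqrtr_gt0.
have -> : ln p - ln q = - (2 * ln (b / a)).
  by rewrite -ap -bq ln_div ?posrE// !lnXn// ?posrE//; ring.
have : ln (b / a) <= b / a - 1.
  by rewrite -ler_expR lnK ?posrE ?divr_gt0//; apply: le_trans (expR_ge1Dx _); rewrite addrC subrK.
move=> h.
have : a ^+ 2 * ln (b / a) <= a * b - a ^+ 2.
  apply: (@le_trans _ _ (a ^+ 2 * (b / a - 1))); first by rewrite ler_wpM2l// exprn_ge0// ltW.
  by rewrite le_eqVlt; apply/orP; left; apply/eqP; field; rewrite gt_eqF.
rewrite -ap -bq; nra.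
Qed.

Lemma gibbs p q : 0 <= p -> 0 <= q -> (q = 0 -> p = 0) ->
  p - q <= p * (ln p - ln q).
Proof.
move=> p0 q0 pq; have := gibbs_sqrt p0 q0 pq.
have := sqr_ge0 (Num.sqrt p - Num.sqrt q); lra.
Qed.

(** Factor [p - q] through the square roots and split the product by the arithmetic-geometric
    inequality. The free parameter [eta] allows summation over words term by term, without a square
    root of the total. *)
Lemma pinsker eta p q : 0 < eta -> 0 <= p -> 0 <= q -> (q = 0 -> p = 0) ->
  `|p - q| <= (p * (ln p - ln q) - p + q) / (2 * eta) + eta * (p + q).
Proof.
move=> eta0 p0 q0 pq; have := gibbs_sqrt p0 q0 pq.
set g := _ - p + q; have := sqr_sqrtr p0; have := sqr_sqrtr q0.
set a := Num.sqrt p; set b := Num.sqrt q => bq ap h.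
have a0 : 0 <= a by exact: sqrtr_ge0.
have b0 : 0 <= b by exact: sqrtr_ge0.
apply: (@le_trans _ _ ((a - b) ^+ 2 / (2 * eta) + eta * (p + q))); last first.
  by rewrite lerD2r ler_pM2r// invr_gt0 mulr_gt0.
rewrite -lerBlDr ler_pdivlMr ?mulr_gt0// -ap -bq.
have -> : a ^+ 2 - b ^+ 2 = (a - b) * (a + b) by ring.
rewrite normrM (ger0_norm (addr_ge0 a0 b0)).
have := sqr_ge0 (`|a - b| - eta * (a + b)).
have : `|a - b| ^+ 2 = (a - b) ^+ 2 by rewrite real_normK// num_real.
have : 0 <= eta ^+ 2 * (a - b) ^+ 2 by rewrite mulr_ge0// sqr_ge0.
set d := `|a - b|; nra.
Qed.

End Gibbs.

Section Entropy.
Context {R : realType} {A : finType} {a0 : A}.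
Local Notation Omega := (Omega a0).
Variable nu : probability Omega R.
Hypothesis nu_inv : shift_invariant nu.
Local Notation P := (prob nu).

Definition cond_entropy n : R := block_entropy n.+1 nu - block_entropy n nu.

Lemma block_entropyE n : block_entropy n nu = - wsum n (fun s => P s * ln (P s)).
Proof. by congr (- _); apply: eq_bigr => a _; rewrite cylinderE. Qed.

Lemma block_entropy0 : block_entropy 0 nu = 0.
Proof. by rewrite block_entropyE wsum0 prob_nil ln1 mulr0 oppr0. Qed.

(** Shift invariance turns the increment into the entropy of a letter given the [n] letters that
    follow it, the direction in which the transfer operator works. *)
Lemma cond_entropyE n : cond_entropy n =
  - wsum n (fun s => \sum_(a : A) P (a :: s) * (ln (P (a :: s)) - ln (P s))).
Proof.
rewrite /cond_entropy !block_entropyE wsum_cons -wsum_exchange -opprD -wsumN -wsumD.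
congr (- _); apply: eq_wsum => s _; rewrite {1}(prob_cons nu_inv s) mulr_suml.
by rewrite -sumrB; apply: eq_bigr => a _; rewrite mulrBr.
Qed.

Lemma cond_entropy_ge0 n : 0 <= cond_entropy n.
Proof.
rewrite cond_entropyE oppr_ge0.
apply: wsum_le0 => s _; apply: sumr_le0 => a _.
have [->|p0] := eqVneq (P (a :: s)) 0; first by rewrite mul0r.
have pgt0 : 0 < P (a :: s) by rewrite lt0r p0 prob_ge0.
rewrite mulr_ge0_le0 ?prob_ge0// subr_le0.
have le := prob_cons_le nu_inv s a.
by rewrite ler_ln ?posrE// (lt_le_trans pgt0).
Qed.

(** Gibbs' inequality between the law of the word [a s b] and the law that makes [a] and [b]
    conditionally independent given [s]. *)
Lemma cond_entropy_le n : cond_entropy n.+1 <= cond_entropy n.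
Proof.
rewrite !cond_entropyE lerN2 wsum_rcons -wsum_exchange -subr_ge0 -wsumB.
apply: wsum_ge0 => s _.
have pz a : P s = 0 -> P (a :: s) = 0.
  by move=> s0; apply/le_anti; rewrite prob_ge0 -{1}s0 prob_cons_le.
(* The two laws have the same mass [P s]; if [P s = 0], both sums vanish. *)
have E : \sum_(b : A) \sum_(a : A)
    (P (rcons (a :: s) b) - P (a :: s) * P (rcons s b) / P s) = 0.
  under eq_bigr do rewrite sumrB.
  rewrite sumrB exchange_big /=.
  under eq_bigr do rewrite -(prob_rcons nu (_ :: s)).
  rewrite -(prob_cons nu_inv s).
  under eq_bigr do rewrite -mulr_suml -mulr_suml -(prob_cons nu_inv s).
  rewrite -mulr_suml -mulr_sumr -(prob_rcons nu s).
  have [->|p0] := eqVneq (P s) 0; first by rewrite !mul0r subrr.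
  by rewrite mulfK// subrr.
have F : \sum_(a : A) P (a :: s) * (ln (P (a :: s)) - ln (P s)) =
    \sum_(b : A) \sum_(a : A)
      P (rcons (a :: s) b) * (ln (P (a :: s)) - ln (P s)).
  rewrite exchange_big; apply: eq_bigr => a _.
  by rewrite {1}(prob_rcons nu (a :: s)) mulr_suml.
rewrite F -[leLHS]E -sumrB; apply: ler_sum => b _; rewrite -sumrB; apply: ler_sum => a _.
have xz : P (rcons (a :: s) b) <= P (rcons s b).
  exact: (prob_cons_le nu_inv (rcons s b) a).
have xy := prob_rcons_le nu (a :: s) b; have yw := prob_cons_le nu_inv s a.
have x0 := prob_ge0 nu (rcons (a :: s) b).
have y0 := prob_ge0 nu (a :: s); have z0 := prob_ge0 nu (rcons s b).
have w0 := prob_ge0 nu s.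
move: x0 y0 z0 w0 xz xy yw.
set x := P (rcons (a :: s) b); set y := P (a :: s).
set z := P (rcons s b); set w := P s => x0 y0 z0 w0 xz xy yw.
have [->|xn0] := eqVneq x 0.
  by rewrite !mul0r subrr sub0r oppr_le0 divr_ge0// mulr_ge0.
have xp : 0 < x by rewrite lt0r xn0.
have yp := lt_le_trans xp xy; have zp := lt_le_trans xp xz.
have wp := lt_le_trans yp yw.
have q0 : 0 < y * z / w by rewrite divr_gt0// mulr_gt0.
apply: le_trans (gibbs x0 (ltW q0) _) _.
  by move=> h; rewrite h ltxx in q0.
rewrite ln_div ?posrE ?mulr_gt0// lnM ?posrE//; lra.
Qed.

Lemma cond_entropy_nonincreasing : nonincreasing_seq cond_entropy.
Proof. by apply/nonincreasing_seqP => n; exact: cond_entropy_le. Qed.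

(** Block entropies are partial sums of a nonincreasing nonnegative sequence, so their averages tend
    to its limit by Cesaro's theorem. *)
Lemma cvg_cond_entropy : cond_entropy @ \oo --> entropy nu.
Proof.
have cv : cvgn cond_entropy.
  apply: nonincreasing_is_cvgn; first exact: cond_entropy_nonincreasing.
  by exists 0 => _ [n _ <-]; exact: cond_entropy_ge0.
suff : (fun n => block_entropy n nu / n%:R) @ \oo --> limn cond_entropy.
  by move/cvg_lim => /= E; rewrite /entropy E//; exact: Rhausdorff.
rewrite -cvg_shiftS /=.
have -> : (fun n => block_entropy n.+1 nu / n.+1%:R) =
    arithmetic_mean cond_entropy.
  apply/funext => n; rewrite /arithmetic_mean mulrC; congr (_ * _).
  by rewrite /series /= telescope_sumr// block_entropy0 subr0.
exact: cesaro cv.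
Qed.

Lemma entropy_le n : entropy nu <= cond_entropy n.
Proof.
have cv := cvg_cond_entropy.
have <- := cvg_lim (@Rhausdorff R) cv.
apply: nonincreasing_cvgn_ge; first exact: cond_entropy_nonincreasing.
by apply/cvg_ex; exists (entropy nu).
Qed.

Lemma entropy_ge l k : (forall n, (k <= n)%N -> l <= cond_entropy n) ->
  l <= entropy nu.
Proof.
move=> lc; have cv := cvg_cond_entropy.
have <- := cvg_lim (@Rhausdorff R) cv.
apply: limr_ge; first by apply/cvg_ex; exists (entropy nu).
by exists k.
Qed.

End Entropy.

(** * Measures with given word probabilities, and Markov approximation *)

Section WordMeasure.
Context {R : realType} {A : finType} {a0 : A}.
Local Notation Omega := (Omega a0).
Variable p : seq A -> R.
Hypotheses (p_ge0 : forall s, 0 <= p s) (p_nil : p [::] = 1)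
  (p_rcons : forall s, p s = \sum_(a : A) p (rcons s a)).

(* The word [s] is given the interval of length [p s] starting at
   [left_end s]; these intervals are nested, and the image of the uniform
   measure under the coding of [t] by the words whose interval contains [t]
   is the measure sought. *)
Let below s k : R := \sum_(b : A | (enum_rank b < k)%N) p (rcons s b).

Let left_end s : R :=
  \sum_(i < size s) below (take i s) (enum_rank (nth a0 s i)).

Let in_word t s : bool := left_end s <= t < left_end s + p s.

Let letter t s : A :=
  if [pick a | in_word t (rcons s a)] is Some a then a else a0.

Let code t := fix code n :=
  if n is m.+1 then rcons (code m) (letter t (code m)) else [::].

Let point (t : R) : Omega := fun k => if 0 <= t < 1 then letter t (code t k) else a0.

Let left_end_rcons s a : left_end (rcons s a) = left_end s + below s (enum_rank a).
Proof.
rewrite /left_end size_rcons big_ord_recr /=; congr (_ + _).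
  apply: eq_bigr => i _; rewrite -cats1 takel_cat ?nth_cat ?ltn_ord//.
  exact: ltnW.
by rewrite nth_rcons ltnn eqxx -cats1 takel_cat// take_size.
Qed.

Let below_S s a : below s (enum_rank a).+1 = below s (enum_rank a) + p (rcons s a).
Proof.
rewrite /below (bigD1 a)//= addrC; congr (_ + _); apply: eq_bigl => b.
rewrite ltnS [in RHS]ltn_neqAle andbC; congr (_ && _).
by rewrite (inj_eq (@ord_inj _)) (inj_eq enum_rank_inj).
Qed.

Let below_mono s k l : (k <= l)%N -> below s k <= below s l.
Proof.
move=> kl; rewrite /below [leRHS](bigID (fun b => (enum_rank b < k)%N))/=.
rewrite [X in _ <= X + _](_ : _ = below s k); last first.
  by apply: eq_bigl => b; apply: andb_idl => bk; exact: leq_trans kl.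
by rewrite lerDl; apply: sumr_ge0.
Qed.

Let below_card s : below s #|A| = p s.
Proof.
by rewrite p_rcons; apply: eq_bigl => b; rewrite ltn_ord.
Qed.

Let in_word_rcons t s a : in_word t (rcons s a) -> in_word t s.
Proof.
rewrite /in_word left_end_rcons => /andP[h1 h2]; apply/andP; split.
  apply: le_trans h1; rewrite lerDl; apply: sumr_ge0 => b _; exact: p_ge0.
apply: lt_le_trans h2 _; rewrite -addrA lerD2l -below_S -below_card.
exact/below_mono/ltn_ord.
Qed.

Let in_word_inj t s a b :
  in_word t (rcons s a) -> in_word t (rcons s b) -> a = b.
Proof.
wlog ab : a b / (enum_rank a <= enum_rank b)%N.
  move=> h; have [|/ltnW] := leqP (enum_rank a) (enum_rank b); first exact: h.
  by move=> /h{}h ha hb; rewrite (h hb ha).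
rewrite /in_word !left_end_rcons => /andP[_ h1] /andP[h2 _].
apply/enum_rank_inj/ord_inj/eqP; rewrite eqn_leq ab leqNgt.
apply/negP => /(below_mono s); rewrite below_S => h.
lra.
Qed.

Let in_word_split t s : in_word t s -> exists a, in_word t (rcons s a).
Proof.
rewrite /in_word -below_card => /andP[h1 h2].
have ex : exists k, t < left_end s + below s k by exists #|A|.
(* The letter sought is the predecessor of the least [k] for which [t] lies below the [k]-th
   dividing point of the interval of [s]. *)
have [[|k] tk mink] := ex_minnP ex.
  move: tk; rewrite /below big_pred0 => [|b]; last by rewrite ltn0.
  by rewrite addr0 => /(le_lt_trans h1); rewrite ltxx.
have kA : (k < #|A|)%N by exact: mink.
exists (enum_val (Ordinal kA)).
have := below_S s (enum_val (Ordinal kA)).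
rewrite left_end_rcons enum_valK /= -addrA => <-; rewrite tk andbT leNgt.
by apply/negP => /mink; rewrite ltnn.
Qed.

Let in_wordP t s a : in_word t s ->
  (letter t s == a) = in_word t (rcons s a).
Proof.
move=> ts; rewrite /letter; case: pickP => [b tb|nt].
  by apply/eqP/idP => [<-//|ta]; exact: in_word_inj tb ta.
by have [b] := in_word_split ts; rewrite nt.
Qed.

Let codeE (t : R) s : 0 <= t < 1 -> (code t (size s) == s) = in_word t s.
Proof.
move=> t01; elim/last_ind: s => [|s a IH].
  by rewrite eqxx /in_word p_nil /left_end big_ord0 add0r t01.
rewrite size_rcons /= eqseq_rcons IH.
have [ts|nts] := boolP (in_word t s).
  by move: (IH); rewrite ts => /eqP ->; rewrite in_wordP.
by apply/esym/negbTE; apply: contra nts; exact: in_word_rcons.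
Qed.

Let mkseq_point (t : R) n : 0 <= t < 1 -> mkseq (point t) n = code t n.
Proof.
move=> t01; elim: n => [//|n IH].
have -> : mkseq (point t) n.+1 = rcons (mkseq (point t) n) (point t n).
  by rewrite /mkseq -addn1 iotaD map_cat cats1.
by rewrite IH /point t01.
Qed.

(** [point] sends everything outside the unit interval to the constant sequence [a0]; this null set
    enters the preimage of each cylinder containing that sequence. *)
Let outside s : set R := if mkseq (fun=> a0) (size s) == s then ~` `[0, 1[ else set0.

Let point_cyl s :
  point @^-1` cyl s = `[left_end s, (left_end s + p s)[ `|` outside s.
Proof.
have in01 t : in_word t s -> 0 <= t < 1.
  elim/last_ind: s => [|s a IH]; last by move/in_word_rcons/IH.
  by rewrite /in_word p_nil /left_end big_ord0 add0r.
apply/seteqP; split=> t; rewrite /outside /cyl /=.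
  have [t01 /eqP ts|nt01 ts] := boolP (0 <= t < 1).
    by left; rewrite in_itv/=; move: ts; rewrite mkseq_point// codeE.
  right; rewrite ifT; first by rewrite /= in_itv/=; exact/negP.
  rewrite -[X in _ == X]ts; apply/eqP/eq_map => i.
  by rewrite /point (negbTE nt01).
rewrite in_itv/= => -[ts|].
  by have t01 := in01 _ ts; apply/eqP; rewrite mkseq_point// codeE.
case: ifPn => [/eqP sE|//]; rewrite /= in_itv/= => /negP nt01.
rewrite -[RHS]sE; apply: eq_map => i.
by rewrite /point (negbTE nt01).
Qed.

Let measurable_outside s : measurable (outside s).
Proof.
by rewrite /outside; case: ifP => _ //; apply: measurableC; exact: measurable_itv.
Qed.

Let measurable_point : measurable_fun setT (point : measurableTypeR R -> Omega).
Proof.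
apply: measurable_fun_cyl => s; rewrite point_cyl.
apply: measurableU; last exact: measurable_outside.
exact: measurable_itv.
Qed.

Let uniform01_itv x y : 0 <= x -> x <= y -> y <= 1 ->
  uniform_prob (@ltr01 R) `[x, y[ = (y - x)%:E.
Proof.
move=> x0 xy y1; rewrite /uniform_prob (eq_integral (fun=> 1%E)).
  rewrite integral_cst//= mul1e lebesgue_measure_itv /= lte_fin.
  by case: ltgtP xy => // ->; rewrite subrr.
move=> t; rewrite inE/= in_itv/= => /andP[xt ty].
rewrite /uniform_pdf (le_trans x0 xt) (le_trans (ltW ty) y1) /=.
by rewrite subr0 invr1.
Qed.

Let left_end_bounds s : 0 <= left_end s /\ left_end s + p s <= 1.
Proof.
elim/last_ind: s => [|s a [IH0 IH1]].
  by rewrite p_nil /left_end big_ord0 add0r.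
rewrite left_end_rcons; split.
  by rewrite addr_ge0// sumr_ge0.
apply: le_trans IH1; rewrite -addrA lerD2l -below_S -below_card.
exact/below_mono/ltn_ord.
Qed.

Lemma word_measure_exists :
  exists nu : probability Omega R, forall s, nu (cyl s) = (p s)%:E.
Proof.
pose X : {mfun measurableTypeR R >-> Omega} :=
    @mfun_Sub _ _ (measurableTypeR R) Omega point (mem_set measurable_point).
exists (distribution (uniform_prob (@ltr01 R)) X) => s.
have [l0 l1] := left_end_bounds s.
rewrite /distribution /pushforward /= point_cyl measureU//=; last 2 first.
- exact: measurable_outside.
- rewrite -subset0 => t [/=]; rewrite in_itv/= /outside => /andP[h1 h2].
  case: ifP => _ //; rewrite /= in_itv/=; apply.
  by rewrite (le_trans l0 h1) (lt_le_trans h2 l1).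
rewrite uniform01_itv// ?lerDl// [_ - left_end s]addrC addKr /outside.
case: ifP => _; last by rewrite measure0 adde0.
rewrite probability_setC// [X in (1 - X)%E](_ : _ = 1%E) ?subee ?adde0//.
by rewrite -[RHS]/(1%:E) -[in RHS](subr0 1); exact: uniform01_itv.
Qed.

End WordMeasure.

(** * Stationary laws of finite stochastic matrices *)

Section StationaryVector.
Context {R : realType} {T : finType}.
Variables (t0 : T) (M : T -> T -> R).
Hypotheses (M0 : forall v u, 0 <= M v u) (M1 : forall v, \sum_(u : T) M v u = 1).

(** Since [M] fixes constants, [M] minus the identity is singular and has a left null vector [w].
    Then [|w| <= |w| M] entrywise with equal totals, so [|w|] is invariant too and can be
    normalized. *)
Lemma stationary_vector : exists pi : T -> R,
  [/\ forall v, 0 <= pi v, \sum_(v : T) pi v = 1 &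
      forall u, \sum_(v : T) pi v * M v u = pi u].
Proof.
pose B : 'M[R]_#|T| := \matrix_(i, j) M (enum_val i) (enum_val j) - 1%:M.
have sumT (F : T -> R) : \sum_(v : T) F v = \sum_(i < #|T|) F (enum_val i).
  rewrite (reindex (fun i : 'I_#|T| => enum_val i))//.
  exact/onW_bij/enum_val_bij.
have B1 : B *m (const_mx 1 : 'cV_#|T|) = 0.
  apply/matrixP => i j; rewrite !mxE.
  under eq_bigr do rewrite !mxE mulr1.
  rewrite sumrB -(sumT (fun u => M _ u)) M1 (bigD1 i)//= eqxx big1 => [|l li].
    by rewrite addr0 subrr.
  by rewrite eq_sym (negbTE li).
have nB : B \notin unitmx.
  apply/negP => uB; have := mulKmx uB (const_mx 1 : 'cV_#|T|).
  rewrite B1 mulmx0 => /matrixP/(_ (enum_rank t0) 0); rewrite !mxE => /eqP.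
  by rewrite eq_sym oner_eq0.
have /rowV0Pn[v vB v0] : kermx B != 0 by rewrite kermx_eq0 row_free_unit.
pose w u := v 0 (enum_rank u).
have wM u : w u = \sum_(y : T) w y * M y u.
  move/sub_kermxP/matrixP/(_ 0 (enum_rank u)): vB; rewrite !mxE.
  under eq_bigr do rewrite !mxE mulrBr.
  rewrite sumrB => /eqP; rewrite subr_eq0 => /eqP h; rewrite sumT.
  under eq_bigr do rewrite /w enum_valK.
  rewrite -[u in RHS]enum_rankK h (bigD1 (enum_rank u))//= eqxx mulr1.
  by rewrite big1 ?addr0// => i iu; rewrite (negbTE iu) mulr0.
pose S := \sum_(u : T) `|w u|.
have S0 : 0 < S.
  rewrite lt0r sumr_ge0 ?andbT//; apply: contra v0 => /eqP S0.
  apply/eqP/matrixP => i j; rewrite ord1 mxE -[j]enum_valK.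
  apply/eqP; rewrite -normr_eq0; apply/eqP.
  exact: (psumr_eq0P _ S0).
have wM' u : \sum_(y : T) `|w y| * M y u = `|w u|.
  have ge0 y : 0 <= \sum_(z : T) `|w z| * M z y - `|w y|.
    rewrite subr_ge0 wM; apply: le_trans (ler_norm_sum _ _ _) _.
    by apply: ler_sum => z _; rewrite normrM (ger0_norm (M0 _ _)).
  have sum0 : \sum_(y : T) (\sum_(z : T) `|w z| * M z y - `|w y|) = 0.
    rewrite sumrB exchange_big /=.
    by under eq_bigr do rewrite -mulr_sumr M1 mulr1; rewrite subrr.
  by apply/eqP; rewrite -subr_eq0; apply/eqP; apply: (psumr_eq0P _ sum0).
exists (fun u => `|w u| / S); split=> [u||u].
- by rewrite divr_ge0// ltW.
- by rewrite -mulr_suml divff// gt_eqF.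
- by rewrite -wM' mulr_suml; apply: eq_bigr => y _; rewrite mulrAC.
Qed.

End StationaryVector.

(** * Stationary Markov measures built from truncated potentials *)

Section MarkovApproximation.
Context {R : realType} {A : finType} {a0 : A}.
Local Notation Omega := (Omega a0).
Variables (psi : Omega -> R) (k : nat).
Hypothesis psi1 : normalized psi.
Local Notation z := ((fun=> a0) : Omega).

Definition truncation (x : Omega) : R := psi (concat (mkseq x k.+1) z).
Local Notation L := (transfer truncation).

Let indic (s : seq A) (x : Omega) : R := (mkseq x (size s) == s)%:R.

Lemma mkseq_concat1 a (x : Omega) n :
  mkseq (concat [:: a] x) n.+1 = a :: mkseq x n.
Proof.
rewrite /mkseq /= -[1%N]addn0 iotaDl -map_comp; congr cons.
by apply: eq_map => i /=; rewrite add1n concat1_S.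
Qed.

Lemma truncation_normalized : normalized truncation.
Proof.
move=> x; rewrite -(psi1 (concat (mkseq x k) z)).
by apply: eq_bigr => a _; rewrite /truncation mkseq_concat1 concat_cons.
Qed.

Let depends_on_truncation : depends_on k.+1 truncation.
Proof. by move=> x y /mkseq_agree xy; rewrite /truncation xy. Qed.

Let depends_on_indic s : depends_on (k + size s) (indic s).
Proof.
by move=> x y /(agree_le (leq_addl _ _))/mkseq_agree xy; rewrite /indic xy.
Qed.

(** Transition matrix on words of length [k]: prepend a letter and keep the first [k] letters. *)
Let weight (v u : k.-tuple A) : R :=
  \sum_(a : A) expR (truncation (concat [:: a] (concat v z))) *
    (mkseq (concat [:: a] (concat v z)) k == u)%:R.

Let stationary_expectation : exists pi : k.-tuple A -> R,
  [/\ forall v, 0 <= pi v, \sum_v pi v = 1 &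
    forall h, depends_on k h -> \sum_v pi v * L h (concat v z) =
      \sum_v pi v * h (concat v z)].
Proof.
have t0 : k.-tuple A by exact: (nseq_tuple k a0).
have [||pi [pi0 pi1 piM]] := @stationary_vector R _ t0 weight.
- by move=> v u; apply: sumr_ge0 => a _; rewrite mulr_ge0 ?expR_ge0.
- move=> v; rewrite exchange_big -[RHS](truncation_normalized (concat v z)).
  apply: eq_bigr => a _; rewrite -mulr_sumr.
  rewrite (_ : \sum_ _ _ = 1) ?mulr1//.
  rewrite -[RHS](wsum_mkseq (concat [:: a] (concat v z)) k (fun=> 1)).
  by apply: eq_bigr => u _; rewrite mulr1; reflexivity.
exists pi; split=> // h lh.
have Lh (v : k.-tuple A) : L h (concat v z) = \sum_(u : k.-tuple A) weight v u * h (concat u z).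
  rewrite /weight; under [RHS]eq_bigr do rewrite mulr_suml.
  rewrite exchange_big; apply: eq_bigr => a _.
  under eq_bigr do rewrite -mulrA.
  rewrite -mulr_sumr; congr (_ * _).
  have := wsum_mkseq (concat [:: a] (concat v z)) k (fun s => h (concat s z)).
  rewrite /wsum => ->; apply: lh.
  exact: agree_concat_mkseq.
under eq_bigr do rewrite Lh mulr_sumr.
rewrite exchange_big; apply: eq_bigr => u _.
rewrite -piM mulr_suml; apply: eq_bigr => v _; exact: mulrA.
Qed.

Let indic_rcons s x : indic s x = \sum_(b : A) indic (rcons s b) x.
Proof.
rewrite (bigD1 (x (size s)))//= big1 => [|b bx].
  rewrite addr0 /indic; congr ((nat_of_bool _)%:R); apply/eqP/eqP => xs.
    by have /cyl_rcons : cyl s x /\ x (size s) = x (size s) by [].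
  by have /cyl_rcons[] : cyl (rcons s (x (size s))) x by [].
rewrite /indic; case: eqP => // xs.
suff /cyl_rcons[_ /eqP] : cyl (rcons s b) x by rewrite eq_sym (negbTE bx).
exact: xs.
Qed.

Let indic_concat1 a b s x : indic (b :: s) (concat [:: a] x) =
  (a == b)%:R * indic s x.
Proof.
by rewrite /indic [size _]/= mkseq_concat1 eqseq_cons -mulnb natrM.
Qed.

Lemma markov_measure_exists : exists nu : probability Omega R,
  shift_invariant nu /\
  forall a s, (k <= size s)%N -> prob nu (a :: s) =
    expR (psi (concat (take k.+1 (a :: s)) z)) * prob nu s.
Proof.
have [pi [pi0 pi1 piL]] := stationary_expectation.
pose E h := \sum_(v : k.-tuple A) pi v * h (concat v z).
(* The chance that the stationary chain spells [s] in [size s] steps. As letters are prepended,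
   additivity over [rcons] comes from stationarity, and additivity over a first letter from
   normalization. *)
pose p s := E (iter (size s) L (indic s)).
have p_cons a s : p (a :: s) = E (iter (size s) L (L (indic (a :: s)))).
  by rewrite /p [size _]/= iterSr.
have [|||nu nuE] := @word_measure_exists R A a0 p.
- move=> s; apply: sumr_ge0 => v _; rewrite mulr_ge0//.
  by apply: transfer_iter_ge0 => x; exact: ler0n.
- by rewrite /p /E /=; under eq_bigr do rewrite mulr1.
- move=> s; rewrite [LHS](_ : _ = E (L (iter (size s) L (indic s)))).
    rewrite -iterS (_ : indic s = fun x => \sum_(b : A) indic (rcons s b) x).
      rewrite /p /E [in RHS]exchange_big; apply: eq_bigr => v _.
      rewrite -mulr_sumr; congr (_ * _); rewrite transfer_iter_sum.
      by apply: eq_bigr => b _; rewrite size_rcons.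
    by apply/funext => x; exact: indic_rcons.
  by rewrite /p /E piL//; exact: depends_on_transfer_iter.
have probE s : prob nu s = p s by rewrite /prob nuE.
exists nu; split=> [B mB|a s ks].
  pose X : {mfun Omega >-> Omega} :=
    @mfun_Sub _ _ Omega Omega left_shift (mem_set measurable_left_shift).
  apply: (@probability_cyl_unique R A a0 (distribution nu X) nu) => // s.
  rewrite [LHS](prob_EFin (distribution nu X)) prob_EFin; congr EFin.
  rewrite {1}/prob /distribution /pushforward /= prob_left_shift.
  under eq_bigr do rewrite probE p_cons.
  rewrite probE /p /E exchange_big; apply: eq_bigr => v _.
  rewrite -mulr_sumr -transfer_iter_sum; congr (_ * iter _ L _ _).
  apply/funext => x; rewrite /transfer exchange_big.
  rewrite -[RHS]mul1r -(truncation_normalized x) mulr_suml.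
  apply: eq_bigr => a _; rewrite -mulr_sumr; congr (_ * _).
  under eq_bigr do rewrite indic_concat1.
  rewrite (bigD1 a)//= eqxx mul1r big1 ?addr0// => b ba.
  by rewrite eq_sym (negbTE ba) mul0r.
rewrite !probE p_cons.
set c := expR _; rewrite /p /E mulr_sumr; apply: eq_bigr => v _.
rewrite mulrCA; congr (_ * _).
(* As [k <= size s], the truncated potential at [a x] is the same for all [x] in the cylinder of
   [s]. *)
have -> : L (indic (a :: s)) = fun x => c * indic s x.
  apply/funext => x; rewrite /transfer (bigD1 a)//= big1 => [|b ba].
    rewrite addr0 indic_concat1 eqxx mul1r /indic.
    case: eqP => [xs|_]; last by rewrite !mulr0.
    rewrite !mulr1 /c /truncation mkseq_concat1.
    by rewrite /= -xs -map_take take_iota (minn_idPl ks).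
  by rewrite indic_concat1 (negbTE ba) mul0r mulr0.
elim: (size s) (concat v z) => [//|n IH] x /=.
rewrite -transfer_scale; congr (L _ x).
by apply/funext => y; exact: IH.
Qed.

End MarkovApproximation.

Section PressureLowerBound.
Context {R : realType} {A : finType} {a0 : A}.
Local Notation Omega := (Omega a0).

(** For the Markov measure of the truncation, entropy plus the integral of the truncation is
    nonnegative, and the truncation is within [e] of [psi]. *)
Lemma pressure_ge0 (psi : Omega -> R) : normalized psi -> ucont psi ->
  forall e, 0 < e -> exists2 nu : probability Omega R, shift_invariant nu &
    - e <= entropy nu + \int[nu]_x psi x.
Proof.
move=> psi1 upsi e e0; have [k psik] := upsi e e0.
have [nu [nu_inv nuE]] := markov_measure_exists k psi1.
exists nu => //; set z : Omega := fun=> a0.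
have utr : ucont (truncation psi k).
  exact: (ucont_mkseq k.+1 (fun s => psi (concat s z))).
have h1 : 0 - \int[nu]_x truncation psi k x <= entropy nu.
  apply: (@entropy_ge _ _ _ nu nu_inv _ k) => n kn; rewrite cond_entropyE//.
  rewrite sub0r lerN2.
  have -> : \int[nu]_x truncation psi k x =
      \int[nu]_x psi (concat (take k.+1 (mkseq x n.+1)) z).
    apply: eq_Rintegral => x _; rewrite /truncation.
    by rewrite -map_take take_iota (minn_idPl _).
  rewrite (Rint_word nu n.+1 (fun s => psi (concat (take k.+1 s) z))).
  rewrite wsum_cons -wsum_exchange; apply: le_wsum => s sn.
  apply: ler_sum => a _; rewrite nuE ?sn//.
  have [->|p0] := eqVneq (prob nu s) 0; first by rewrite mulr0 !mul0r.
  rewrite lnM ?posrE ?expR_gt0 ?expRK ?lt0r ?p0 ?prob_ge0//.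
  by rewrite addrK.
have : `|\int[nu]_x (psi x - truncation psi k x)| <= e.
  apply: Rint_bound; first exact: ucontB.
  move=> x; apply: psik; apply: (agree_le (leqnSn k)).
  exact: agree_concat_mkseq.
rewrite RintB// ler_norml => /andP[h2 _]; lra.
Qed.

End PressureLowerBound.

(** * Equilibrium states are invariant under the transfer operator *)

Section TransferInvariance.
Context {R : realType} {A : finType} {a0 : A}.
Local Notation Omega := (Omega a0).
Variables (mu : probability Omega R) (psi : Omega -> R).
Hypotheses (mu_inv : shift_invariant mu) (psi1 : normalized psi)
  (upsi : ucont psi).
Local Notation P := (prob mu).
Local Notation z := ((fun=> a0) : Omega).

(** Law of a word [a s] when [s] is drawn from [mu] and [a] from the transition probabilities at [s]
    completed by [z]. *)
Let q a s : R := P s * expR (psi (concat (a :: s) z)).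

Let sum_q m : wsum m (fun s => \sum_(a : A) q a s) = 1.
Proof.
rewrite -(wsum_prob mu m); apply: eq_wsum => s _; rewrite -mulr_sumr.
under eq_bigr do rewrite concat_cons.
by rewrite psi1 mulr1.
Qed.

(** The relative entropy of [P] with respect to [q] is minus the conditional entropy minus the mean
    of [psi], the latter up to [d]. The conditional entropy is at least the entropy, and the
    pressure is nonnegative. *)
Let relative_entropy_le m d : 0 <= entropy mu + \int[mu]_x psi x ->
  (forall x y, agree m.+1 x y -> `|psi x - psi y| <= d) ->
  wsum m (fun s => \sum_(a : A) P (a :: s) * (ln (P (a :: s)) - ln (q a s))) <= d.
Proof.
move=> F0 psid.
have := Rint_approx mu upsi psid z.
have := entropy_le mu_inv m; rewrite cond_entropyE//.
have -> : wsum m (fun s =>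
    \sum_(a : A) P (a :: s) * (ln (P (a :: s)) - ln (q a s))) =
  wsum m (fun s => \sum_(a : A) P (a :: s) * (ln (P (a :: s)) - ln (P s))) -
  wsum m.+1 (fun s => P s * psi (concat s z)).
  rewrite wsum_cons -wsum_exchange -wsumB; apply: eq_wsum => s _.
  rewrite -sumrB; apply: eq_bigr => a _.
  have [->|p0] := eqVneq (P (a :: s)) 0; first by rewrite !mul0r subr0.
  have pa : 0 < P (a :: s) by rewrite lt0r p0 prob_ge0.
  have ps : 0 < P s by apply: lt_le_trans pa (prob_cons_le mu_inv s a).
  by rewrite /q lnM ?posrE ?expR_gt0// expRK; ring.
rewrite ler_norml => h /andP[_ h2]; move: h h2 F0; lra.
Qed.

Lemma transfer_invariant : 0 <= entropy mu + \int[mu]_x psi x ->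
  forall f, ucont f -> \int[mu]_x transfer psi f x = \int[mu]_x f x.
Proof.
move=> F0 f uf; have [M M0 fM] := ucont_bounded uf.
apply/eqP; rewrite -subr_eq0 -normr_le0; apply/ler_addgt0Pr => e e0.
rewrite add0r.
(* With these choices Pinsker's bound is [3 * eta], which costs [3 * e / 8]; approximating the two
   integrals costs [e / 4] each. *)
pose eta := e / (8 * M).
have eta0 : 0 < eta by rewrite divr_gt0// mulr_gt0.
pose d := 2 * eta * eta.
have d0 : 0 < d by rewrite mulr_gt0// mulr_gt0.
have e40 : 0 < e / 4 by rewrite divr_gt0.
have uLf : ucont (transfer psi f) by exact: ucont_transfer.
have [m1 h1] := uLf _ e40; have [m2 h2] := uf _ e40; have [m3 h3] := upsi d0.
pose m := maxn m1 (maxn m2 m3).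
have m1m : (m1 <= m)%N by rewrite leq_maxl.
have m2m : (m2 <= m.+1)%N by rewrite leqW// /m leq_max leq_max leqnn orbT.
have m3m : (m3 <= m.+1)%N by rewrite leqW// /m leq_max leq_max leqnn !orbT.
have k1 := Rint_approx mu uLf (fun x y xy => h1 x y (agree_le m1m xy)) z.
have k2 := Rint_approx mu uf (fun x y xy => h2 x y (agree_le m2m xy)) z.
have k3 := relative_entropy_le F0 (fun x y xy => h3 x y (agree_le m3m xy)).
have q0 a s : 0 <= q a s by rewrite mulr_ge0 ?prob_ge0 ?expR_ge0.
have qp a s : q a s = 0 -> P (a :: s) = 0.
  move/eqP; rewrite mulf_eq0 (gt_eqF (expR_gt0 _)) orbF => /eqP s0.
  by apply/le_anti; rewrite prob_ge0 -{1}s0 prob_cons_le.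
have k4 : wsum m (fun s => \sum_(a : A) `|P (a :: s) - q a s|) <=
    d / (2 * eta) + 2 * eta.
  apply: (@le_trans _ _ (wsum m (fun s => \sum_(a : A)
      ((P (a :: s) * (ln (P (a :: s)) - ln (q a s)) - P (a :: s) + q a s) /
        (2 * eta) + eta * (P (a :: s) + q a s))))).
    apply: le_wsum => s _; apply: ler_sum => a _.
    by apply: pinsker => //; [exact: prob_ge0|exact: qp].
  have sum_P : wsum m (fun s => \sum_(a : A) P (a :: s)) = 1.
    by rewrite wsum_exchange -wsum_cons wsum_prob.
  rewrite [leLHS](_ : _ = (wsum m (fun s =>
      \sum_(a : A) P (a :: s) * (ln (P (a :: s)) - ln (q a s))) -
      wsum m (fun s => \sum_(a : A) P (a :: s)) +
      wsum m (fun s => \sum_(a : A) q a s)) / (2 * eta) +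
      eta * (wsum m (fun s => \sum_(a : A) P (a :: s)) +
             wsum m (fun s => \sum_(a : A) q a s))).
    rewrite sum_P sum_q subrK -[1 + 1]/(2 : R) (mulrC eta) lerD2r.
    by rewrite ler_pM2r// invr_gt0 mulr_gt0.
  rewrite -wsumB -!wsumD [_ / _]mulrC -!wsumZ -wsumD.
  apply: eq_wsum => s _; rewrite -sumrB -!big_split /= !mulr_sumr -big_split.
  by apply: eq_bigr => a _; rewrite /= [_ / _]mulrC.
have k5 : `|wsum m (fun s => P s * transfer psi f (concat s z)) -
    wsum m.+1 (fun s => P s * f (concat s z))| <= M * (d / (2 * eta) + 2 * eta).
  rewrite wsum_cons -wsum_exchange -wsumB.
  apply: (@le_trans _ _ (M * wsum m (fun s => \sum_(a : A) `|P (a :: s) - q a s|))).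
    rewrite -wsumZ; apply: le_trans (ler_norm_sum _ _ _) _.
    apply: ler_sum => s _; rewrite mulr_sumr -sumrB.
    apply: le_trans (ler_norm_sum _ _ _) _; rewrite mulr_sumr.
    apply: ler_sum => a _; rewrite -concat_cons mulrA -mulrBl normrM mulrC.
    by rewrite distrC ler_wpM2r.
  by apply: ler_wpM2l; [exact: ltW|].
have E : M * (d / (2 * eta) + 2 * eta) = e / 4 + e / 8.
  by rewrite /d /eta; field; rewrite !gt_eqF.
rewrite E in k5; move: k1 k2 k5; rewrite !ler_norml.
move=> /andP[? ?] /andP[? ?] /andP[? ?]; apply/andP; split; lra.
Qed.

Hypothesis F0 : 0 <= entropy mu + \int[mu]_x psi x.

Lemma prob_consE a s :
  P (a :: s) = \int[mu]_x (expR (psi (concat [:: a] x)) * (mkseq x (size s) == s)%:R).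
Proof.
rewrite -Rint_cyl -transfer_invariant => [|//|]; last first.
  exact: (ucont_mkseq _ (fun t => (t == a :: s)%:R)).
apply: eq_Rintegral => x _; rewrite /transfer (bigD1 a)//= big1 => [|b ba].
  by rewrite addr0 mkseq_concat1 eqseq_cons eqxx.
by rewrite mkseq_concat1 eqseq_cons (negbTE ba) mulr0.
Qed.

Lemma prob_cons_lower a s c : (forall x, cyl s x -> c <= expR (psi (concat [:: a] x))) ->
  c * P s <= P (a :: s).
Proof.
move=> cE; rewrite prob_consE -Rint_cyl -RintZ; last first.
  exact: (ucont_mkseq _ (fun t => (t == s)%:R)).
apply: le_Rint.
- apply: ucontM; first exact: ucont_cst.
  exact: (ucont_mkseq _ (fun t => (t == s)%:R)).
- apply: ucontM; first exact/ucont_expR/(@ucont_concat1 _ _ _ a psi).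
  exact: (ucont_mkseq _ (fun t => (t == s)%:R)).
- by move=> x; case: eqP => [/cE h|_]; rewrite ?mulr1 ?mulr0.
Qed.

Lemma prob_cons_upper a s c : (forall x, cyl s x -> expR (psi (concat [:: a] x)) <= c) ->
  P (a :: s) <= c * P s.
Proof.
move=> cE; rewrite prob_consE -Rint_cyl -RintZ; last first.
  exact: (ucont_mkseq _ (fun t => (t == s)%:R)).
apply: le_Rint.
- apply: ucontM; first exact/ucont_expR/(@ucont_concat1 _ _ _ a psi).
  exact: (ucont_mkseq _ (fun t => (t == s)%:R)).
- apply: ucontM; first exact: ucont_cst.
  exact: (ucont_mkseq _ (fun t => (t == s)%:R)).
- by move=> x; case: eqP => [/cE h|_]; rewrite ?mulr1 ?mulr0.
Qed.

Lemma prob_gt0 s : 0 < P s.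
Proof.
have [M M0 psiM] := ucont_bounded upsi.
elim: s => [|a s IH]; first by rewrite prob_nil.
apply: (@lt_le_trans _ _ (expR (- M) * P s)).
  by rewrite mulr_gt0// expR_gt0.
apply: prob_cons_lower => x _; rewrite ler_expR.
by have := psiM (concat [:: a] x); rewrite ler_norml => /andP[].
Qed.

End TransferInvariance.

Section EquilibriumStates.
Context {R : realType} {A : finType} {a0 : A}.
Local Notation Omega := (Omega a0).
Implicit Types (mu : probability Omega R) (psi : Omega -> R).

Lemma equilibrium_pressure_ge0 psi mu : normalized psi -> ucont psi ->
  equilibrium_state psi mu -> 0 <= entropy mu + \int[mu]_x psi x.
Proof.
move=> psi1 upsi [_ max]; apply/ler_addgt0Pr => e e0.
have [nu nu_inv h] := pressure_ge0 psi1 upsi e0.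
have := le_trans h (max _ nu_inv); lra.
Qed.

Lemma equilibrium_cohomologous psi (g : Omega -> R) mu :
  ucont psi -> ucont g ->
  equilibrium_state (fun x => psi x + (g (left_shift x) - g x)) mu ->
  equilibrium_state psi mu.
Proof.
move=> upsi ug; have ugT : ucont (fun x => g (left_shift x)).
  exact: ucont_left_shift.
have E nu : shift_invariant nu ->
    \int[nu]_x (psi x + (g (left_shift x) - g x)) = \int[nu]_x psi x.
  move=> nu_inv; rewrite RintD//; last exact: ucontB.
  by rewrite RintB// Rint_left_shift// subrr addr0.
move=> [mu_inv max]; split=> // nu nu_inv.
by have := max _ nu_inv; rewrite !E.
Qed.

End EquilibriumStates.

(** * Gaussian concentration *)

Section ExponentialMoment.
Context {R : realType}.
Implicit Types t : R.

(** Square and invert [1 - t / 2 <= expR (- (t / 2))]. The product of [(1 - t / 2) ^+ 2] and the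
    right-hand side exceeds 1 by exactly [t ^+ 2 * ((1 - t) * (5 / 4 - t / 2))]. *)
Lemma expR_le_quadratic t : `|t| <= 1 -> expR t <= 1 + t + 2 * t ^+ 2.
Proof.
rewrite ler_norml => /andP[t0 t1].
have h : 0 < 1 - t / 2 by lra.
have e1 : 1 - t / 2 <= expR (- (t / 2)) by have := expR_ge1Dx (- (t / 2)).
have e2 : expR (t / 2) <= (1 - t / 2)^-1.
  have -> : expR (t / 2) = (expR (- (t / 2)))^-1 by rewrite -expRN opprK.
  by rewrite lef_pV2 ?posrE ?expR_gt0.
have -> : expR t = expR (t / 2) * expR (t / 2) by rewrite -expRD -splitr.
apply: (@le_trans _ _ ((1 - t / 2)^-1 * (1 - t / 2)^-1)).
  by apply: ler_pM; rewrite ?expR_ge0.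
rewrite -invfM -[leLHS]mul1r ler_pdivrMr ?mulr_gt0//.
have : 0 <= t ^+ 2 * ((1 - t) * (5 / 4 - t / 2)).
  by apply: mulr_ge0; [exact: sqr_ge0|apply: mulr_ge0; lra].
nra.
Qed.

Lemma expR_le_square t : expR t <= t + expR (2 * t ^+ 2).
Proof.
have [t1|t1] := leP `|t| 1.
  apply: le_trans (expR_le_quadratic t1) _.
  have := expR_ge1Dx (2 * t ^+ 2); lra.
have [t0|t0] := leP 0 t.
  rewrite ger0_norm// in t1.
  apply: (@le_trans _ _ (expR (2 * t ^+ 2))); last by rewrite lerDr.
  rewrite ler_expR; nra.
rewrite ltr0_norm// in t1.
apply: (@le_trans _ _ 1); first by rewrite -expR0 ler_expR ltW.
have := expR_ge1Dx (2 * t ^+ 2); nra.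
Qed.

(** Centre [h] at its mean and apply [expR_le_square]: the linear term averages to zero. *)
Lemma hoeffding (A : finType) (p h : A -> R) (r : R) :
  (forall a, 0 <= p a) -> \sum_(a : A) p a = 1 ->
  (forall a b, `|h a - h b| <= r) ->
  \sum_(a : A) p a * expR (h a) <= expR (\sum_(a : A) p a * h a + 2 * r ^+ 2).
Proof.
move=> p0 p1 hr; set m := \sum_(a : A) p a * h a.
have dev a : `|h a - m| <= r.
  have -> : h a - m = \sum_(b : A) p b * (h a - h b).
    under eq_bigr do rewrite mulrBr.
    by rewrite sumrB -mulr_suml p1 mul1r.
  apply: le_trans (ler_norm_sum _ _ _) _.
  rewrite -[leRHS]mul1r -p1 mulr_suml; apply: ler_sum => b _.
  by rewrite normrM ger0_norm// ler_wpM2l.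
rewrite expRD -ler_pdivrMl ?expR_gt0// -expRN mulr_sumr.
apply: (@le_trans _ _ (\sum_(a : A) p a * ((h a - m) + expR (2 * r ^+ 2)))).
  apply: ler_sum => a _; rewrite mulrCA -expRD addrC ler_wpM2l//.
  apply: le_trans (expR_le_square _) _; rewrite lerD2l ler_expR.
  rewrite ler_wpM2l// -[leLHS]real_normK ?num_real//.
  by rewrite lerXn2r// ?nnegrE// (le_trans _ (dev a)).
under eq_bigr do rewrite mulrDr mulrBr.
by rewrite big_split sumrB /= -!mulr_suml p1 !mul1r subrr add0r.
Qed.

(** Cauchy-Schwarz, read off from the nonnegative sum of [(B * c i - Q) ^+ 2 * w i]. *)
Lemma sqr_weighted_sum (I : finType) (P : pred I) (c w : I -> R) (B : R) :
  0 < B -> (forall i, 0 <= w i) -> \sum_(i | P i) w i <= B ->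
  (\sum_(i | P i) c i * w i) ^+ 2 <= B * \sum_(i | P i) c i ^+ 2 * w i.
Proof.
move=> B0 w0 wB; set Q := \sum_(i | _) c i * w i; set Z := \sum_(i | _) _.
have QE : \sum_(i | P i) c i * w i = Q by [].
clearbody Q; have : 0 <= \sum_(i | P i) (B * c i - Q) ^+ 2 * w i.
  by apply: sumr_ge0 => i _; rewrite mulr_ge0// sqr_ge0.
have -> : \sum_(i | P i) (B * c i - Q) ^+ 2 * w i =
    B ^+ 2 * Z - 2 * B * Q * Q + Q ^+ 2 * \sum_(i | P i) w i.
  have -> : 2 * B * Q * Q = \sum_(i | P i) 2 * B * Q * (c i * w i).
    by rewrite -mulr_sumr QE.
  rewrite /Z !mulr_sumr -sumrB -big_split; apply: eq_bigr => i _ /=; ring.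
move=> h; rewrite -(ler_pM2l B0).
have : Q ^+ 2 * \sum_(i | P i) w i <= Q ^+ 2 * B by rewrite ler_wpM2l// sqr_ge0.
nra.
Qed.

End ExponentialMoment.

Section ConvolutionSums.
Context {R : realType}.
Variables (w : nat -> R) (B : R).
Hypotheses (w0 : forall m, 0 <= w m) (wB : forall M, \sum_(m < M) w m <= B).

Lemma sum_reversed n k : \sum_(i < n | (i <= k)%N) w (k - i) <= B.
Proof.
apply: le_trans (wB k.+1).
elim: n k => [|n IH] k; first by rewrite big_ord0 sumr_ge0.
rewrite big_mkcond big_ord_recl -big_mkcond /= subn0.
case: k => [|k].
  by rewrite big_pred0 => [|i]; rewrite ?ltn0// addr0 big_ord_recl big_ord0 addr0.
by rewrite addrC [leRHS]big_ord_recr /= lerD2r; exact: IH.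
Qed.

Lemma sum_delayed i K : \sum_(k < K | (i <= k)%N) w (k - i) <= B.
Proof.
elim: i K => [|i IH] K.
  by under eq_bigr do rewrite subn0; exact: wB.
case: K => [|K]; first by rewrite big_ord0; have := wB 0; rewrite big_ord0.
by rewrite big_mkcond big_ord_recl -big_mkcond /= add0r; exact: IH.
Qed.

End ConvolutionSums.

Section GaussianConcentration.
Context {R : realType} {A : finType} {a0 : A}.
Local Notation Omega := (Omega a0).
Variables (mu : probability Omega R) (phi : Omega -> R).
Variables (v : nat -> R) (S theta : R).
Hypotheses (phi1 : normalized phi) (uphi : ucont phi)
  (inv : forall f, ucont f -> \int[mu]_x transfer phi f x = \int[mu]_x f x)
  (v0 : forall k, 0 <= v k) (v_dec : forall k, v k.+1 <= v k)
  (vS : forall J, \sum_(j < J) v j <= S)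
  (phiv : forall k a (x y : Omega), agree k x y ->
    `|phi (concat [:: a] x) - phi (concat [:: a] y)| <= v k)
  (theta01 : 0 < theta < 1).

Let gamma k : R := 1 - expR (- v k).

Let gamma01 k : 0 <= gamma k <= 1.
Proof.
by rewrite subr_ge0 -{1}expR0 ler_expR oppr_le0 v0 /= gerBl expR_ge0.
Qed.

Let gamma_dec k : gamma k.+1 <= gamma k.
Proof. by rewrite lerD2l lerN2 ler_expR lerN2. Qed.

Let gamma_overlap k x y : agree k x y -> 1 - gamma k <= overlap phi phi x y.
Proof.
move=> xy; rewrite subKr; apply: overlap_ge => [|a].
  by rewrite -expR0 ler_expR oppr_le0.
rewrite ler_expR; have := phiv a xy; rewrite ler_norml => /andP[_]; lra.
Qed.

Local Notation w := (memory theta gamma).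
Let B := expR S / (1 - theta).

Let w0 m : 0 <= w m.
Proof. exact: memory_ge0. Qed.

Let wB M : \sum_(m < M) w m <= B.
Proof.
apply: memory_sum => // N.
have := @renewal_sum0_bound R gamma v 0 S _ _ _ _ _ vS N.
rewrite mulr0 addr0 mulr1; apply=> //.
- by move=> k; case/andP: (gamma01 k).
- by move=> k; case/andP: (gamma01 k).
- by move=> k; rewrite addr0.
Qed.

Let B0 : 0 < B.
Proof.
by case/andP: theta01 => _ th1; rewrite divr_gt0 ?expR_gt0// subr_gt0.
Qed.

Section Observable.
Variables (n : nat) (c : 'I_n -> R) (f : Omega -> R).
Hypotheses (c0 : forall i, 0 <= c i) (uf : ucont f)
  (fc : forall x y, `|f x - f y| <= \sum_(i < n)
    c i * dist theta (iter i left_shift x) (iter i left_shift y)).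

(** Coordinate [i] of [f] reads the coupled pair as it was after [k - i] steps, whence the
    convolution. *)
Let osc k : R := \sum_(i < n | (i <= k)%N) c i * w (k - i).

Let osc_ge0 k : 0 <= osc k.
Proof. by apply: sumr_ge0 => i _; rewrite mulr_ge0. Qed.

(** Coordinates [i <= k] are controlled by [memory]. A coordinate [i > k] reads the starting points
    shifted at least once, so it disappears when their shifts agree; there is none when
    [n <= k.+1]. *)
Let transfer_iter_osc k x y :
  (n <= k.+1)%N \/ left_shift x = left_shift y ->
  `|iter k (transfer phi) f x - iter k (transfer phi) f y| <= osc k.
Proof.
suff h x' y' : (n <= k.+1)%N \/ left_shift x' = left_shift y' ->
    iter k (transfer phi) f x' - iter k (transfer phi) f y' <= osc k.
  move=> xy; rewrite ler_norml; apply/andP; split; last exact: h.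
  rewrite lerNl opprB; apply: h.
  by case: xy => [|xy]; [left|right].
move=> {x y} xy; rename x' into x, y' into y.
rewrite -(coupling_iter_left phi1 phi1 k f x y).
rewrite -(coupling_iter_right phi phi1 k f x y) -mulN1r.
rewrite -coupling_iterZ -coupling_iterD.
apply: (@le_trans _ _ (iter k (coupling phi phi) (fun u t =>
    \sum_(i < n) c i *
      dist theta (iter i left_shift u) (iter i left_shift t)) x y)).
  apply: coupling_iter_le => u t; rewrite mulN1r.
  exact: le_trans (ler_norm _) (fc u t).
rewrite coupling_iter_sum [leRHS]big_mkcond; apply: ler_sum => i _.
rewrite coupling_iterZ; case: leqP => ik.
  rewrite ler_wpM2l// (coupling_iter_shifts phi1 phi1 _ _ _ ik).
  exact: coupling_iter_dist.
case: xy => [nk|xy].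
  by have := leq_trans (ltn_ord i) nk; rewrite ltnS leqNgt ik.
rewrite (_ : iter k _ _ _ _ = 0) ?mulr0//.
pose F (u t : Omega) := dist theta (iter (i - k) left_shift u) (iter (i - k) left_shift t).
have -> : (fun u t : Omega => dist theta (iter i left_shift u) (iter i left_shift t)) =
    (fun u t => F (iter k left_shift u) (iter k left_shift t)).
  apply/funext => u; apply/funext => t.
  by rewrite /F -!iterD subnK// ltnW.
rewrite (coupling_iter_shifts phi1 phi1 F _ _ (leqnn k)) subnn /= /F.
have -> : (i - k)%N = (i - k).-1.+1 by rewrite prednK// subn_gt0.
by rewrite !iterSr xy dist_xx.
Qed.

(** Invariance inserts one transfer operator under the integral, and Hoeffding's inequality applies
    at each [x], because the points [a x] all have the same shift. *)
Let exp_moment_step k : \int[mu]_x expR (iter k (transfer phi) f x) <=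
  expR (2 * osc k ^+ 2) * \int[mu]_x expR (iter k.+1 (transfer phi) f x).
Proof.
have ui j : ucont (iter j (transfer phi) f) by exact: ucont_transfer_iter.
have ue j : ucont (fun x => expR (iter j (transfer phi) f x)).
  exact: ucont_expR.
rewrite -inv// -RintZ//; apply: le_Rint; first exact: ucont_transfer.
  by apply: ucontM => //; exact: ucont_cst.
move=> x; rewrite -expRD addrC /=; apply: hoeffding => //.
move=> a b; apply: transfer_iter_osc; right.
by rewrite !left_shiftK.
Qed.

Let exp_moment_iter k : \int[mu]_x expR (f x) <=
  expR (2 * \sum_(j < k) osc j ^+ 2) *
  \int[mu]_x expR (iter k (transfer phi) f x).
Proof.
elim: k => [|k IH]; first by rewrite big_ord0 mulr0 expR0 mul1r.
apply: le_trans IH _; rewrite big_ord_recr /= mulrDr expRD -mulrA.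
by rewrite ler_wpM2l ?expR_ge0//; exact: exp_moment_step.
Qed.

Let transfer_iter_mean k x : (n <= k.+1)%N ->
  iter k (transfer phi) f x <= \int[mu]_y f y + osc k.
Proof.
move=> nk; have ui j : ucont (iter j (transfer phi) f).
  exact: ucont_transfer_iter.
have -> : \int[mu]_y f y = \int[mu]_y iter k (transfer phi) f y.
  by elim: (k) => [//|j ->] /=; rewrite -inv.
rewrite -lerBlDr -[leLHS](Rint_cst mu).
apply: le_Rint => //; first exact: ucont_cst.
move=> y /=; have := @transfer_iter_osc k x y (or_introl nk).
rewrite ler_norml => /andP[_]; lra.
Qed.

Let sum_osc_sqr K : \sum_(k < K) osc k ^+ 2 <= B ^+ 2 * \sum_(i < n) c i ^+ 2.
Proof.
apply: (@le_trans _ _ (\sum_(k < K) B *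
    \sum_(i < n | (i <= k)%N) c i ^+ 2 * w (k - i))).
  apply: ler_sum => k _; apply: sqr_weighted_sum => //.
  exact: sum_reversed.
rewrite -mulr_sumr expr2 -mulrA ler_wpM2l ?(ltW B0)//.
rewrite (exchange_big_dep predT)//= mulr_sumr; apply: ler_sum => i _.
rewrite -mulr_sumr mulrC ler_wpM2r ?sqr_ge0//.
exact: sum_delayed.
Qed.

Let sum_osc K : \sum_(k < K) osc k <= B * \sum_(i < n) c i.
Proof.
rewrite (exchange_big_dep predT)//= mulr_sumr; apply: ler_sum => i _.
rewrite -mulr_sumr mulrC ler_wpM2r//.
exact: sum_delayed.
Qed.

(** The [osc k] have bounded partial sums, so they cannot all stay above [d]. *)
Let small_osc d : 0 < d -> exists2 k, (n <= k.+1)%N & osc k <= d.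
Proof.
move=> d0; apply: contrapT => h.
have dosc k : d <= osc (n + k).
  rewrite leNgt; apply/negP => /ltW hk; apply: h; exists (n + k)%N => //.
  by rewrite -addnS leq_addr.
have [N hN] : exists N : nat, B * \sum_(i < n) c i < d * N%:R.
  exists (Num.truncn (B * (\sum_(i < n) c i) / d)).+1.
  by rewrite -ltr_pdivrMl// [_^-1 * _]mulrC truncnS_gt.
have := sum_osc (n + N); rewrite leNgt => /negP; apply.
apply: lt_le_trans hN _.
rewrite -(big_mkord predT osc) (big_cat_nat (n := n))//= ?leq_addr//.
apply: (@le_trans _ _ (\sum_(n <= i < n + N) osc i)); last first.
  by rewrite lerDr sumr_ge0.
rewrite -{1}[n]add0n big_addn addKn mulr_natr -[X in d *+ X]subn0.
rewrite -sumr_const_nat; apply: ler_sum => k _; rewrite addnC; exact: dosc.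
Qed.

Lemma exp_moment : \int[mu]_x expR (f x) <=
  expR (\int[mu]_x f x) * expR (2 * B ^+ 2 * \sum_(i < n) c i ^+ 2).
Proof.
rewrite -expRD; set t := _ + _; set X := Rintegral _ _ _.
have [X0|X0] := leP X 0; first exact: le_trans X0 (expR_ge0 _).
(* Taking logarithms makes the error [d] additive, so that it can be sent to 0. *)
rewrite -[X]lnK ?posrE// ler_expR; apply/ler_addgt0Pr => d d0.
have [k nk kd] := small_osc d0.
rewrite -ler_expR lnK ?posrE//.
apply: le_trans (exp_moment_iter k) _.
apply: (@le_trans _ _ (expR (2 * \sum_(j < k) osc j ^+ 2) *
    expR (\int[mu]_x f x + d))).
  rewrite ler_wpM2l ?expR_ge0// -[leRHS](Rint_cst mu).
  apply: le_Rint; last 1 first.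
  - move=> x /=; rewrite ler_expR; apply: le_trans (transfer_iter_mean x nk) _.
    by rewrite lerD2l.
  - exact/ucont_expR/ucont_transfer_iter.
  - exact: ucont_cst.
rewrite -expRD ler_expR /t; have := sum_osc_sqr k; lra.
Qed.

End Observable.

(** [Z m] takes its first [m] points from [Y] and the others from [X]; consecutive hybrids differ in
    one place. *)
Lemma hybrid_lipschitz n (K : ('I_n -> Omega) -> R) (c : 'I_n -> R) :
  (forall i, is_lip_const theta K i (c i)) -> forall X Y : 'I_n -> Omega,
  `|K X - K Y| <= \sum_(i < n) c i * dist theta (X i) (Y i).
Proof.
move=> Kc X Y.
pose Z m := fun i : 'I_n => if (i < m)%N then Y i else X i.
suff h : forall m, (m <= n)%N -> `|K X - K (Z m)| <=
    \sum_(i < n | (i < m)%N) c i * dist theta (X i) (Y i).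
  have -> : Y = Z n by apply/funext => i; rewrite /Z ltn_ord.
  apply: le_trans (h _ (leqnn n)) _.
  rewrite [leLHS](eq_bigl predT) => [|i]; last by rewrite ltn_ord.
  by apply: ler_sum => i _; rewrite /Z ltn_ord.
elim=> [|m IH] mn.
  have -> : Z 0 = X by apply/funext => i; rewrite /Z ltn0.
  by rewrite subrr normr0; apply: sumr_ge0 => i; rewrite ltn0.
pose im := Ordinal mn.
rewrite (bigD1 im)//= addrC.
rewrite (_ : K X - K (Z m.+1) = (K X - K (Z m)) + (K (Z m) - K (Z m.+1))); last by ring.
apply: le_trans (ler_normD _ _) _; apply: lerD.
  apply: le_trans (IH (ltnW mn)) _; rewrite le_eqVlt; apply/orP; left.
  apply/eqP/eq_bigl => i; rewrite ltnS [RHS]andbC -val_eqE /=.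
  by rewrite -ltn_neqAle.
have [_ /(_ (Z m) (Z m.+1))] := Kc im.
rewrite /Z /= ltnn ltnSn; apply=> j jm.
by rewrite ltnS [in RHS]leq_eqVlt -[_ == m]/(val j == val im) val_eqE (negbTE jm).
Qed.

(** The infimum is attained: divide by the distance when it is positive; at distance zero any
    Lipschitz constant gives equality. *)
Lemma lip_constP n (K : ('I_n -> Omega) -> R) i :
  separately_lipschitz theta K -> is_lip_const theta K i (lip_const theta K i).
Proof.
move=> /(_ i)[L KL].
have lb : has_lbound [set L | is_lip_const theta K i L] by exists 0 => M [].
split; first by apply: lb_le_inf; [exists L|move=> M []].
move=> X X' XX'.
have [d0|] := leP (dist theta (X i) (X' i)) 0.
  have d00 : dist theta (X i) (X' i) = 0.
    by apply/le_anti; rewrite d0 dist_ge0.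
  by case: KL => _ /(_ X X' XX'); rewrite d00 !mulr0.
move=> d0; rewrite -ler_pdivrMr//; apply: lb_le_inf; first by exists L.
by move=> M [M0 KM]; rewrite ler_pdivrMr//; exact: KM.
Qed.

Lemma gaussian_concentration_holds C : 2 * B ^+ 2 <= C ->
  gaussian_concentration theta mu C.
Proof.
move=> BC n K n0 KL; pose c := lip_const theta K.
have Kc i : is_lip_const theta K i (c i) by exact: lip_constP.
have c0 i : 0 <= c i by case: (Kc i).
pose f x := K (fun i => iter i left_shift x).
have fc x y : `|f x - f y| <= \sum_(i < n)
    c i * dist theta (iter i left_shift x) (iter i left_shift y).
  exact: hybrid_lipschitz.
have uf : ucont f.
  move=> e e0; pose s := 1 + \sum_(i < n) c i.
  have s0 : 0 < s by rewrite ltr_pwDl// sumr_ge0.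
  (* Points with [n + m] common letters still share [m] letters in each of the [n] coordinates, so
     [f] moves by at most [e / s] times the sum of the [c i]. *)
  have [m tm] : exists m, theta ^+ m <= e / s.
    have /cvgrPdist_le/(_ (e / s)) : (fun m => theta ^+ m) @ \oo --> (0 : R).
      apply: cvg_expr; case/andP: theta01 => t0 t1.
      by rewrite ger0_norm// ltW.
    rewrite divr_gt0// => /(_ isT)[m _ /(_ m (leqnn m))] /=.
    by rewrite sub0r normrN => h; exists m; exact: le_trans (ler_norm _) h.
  exists (n + m)%N => x y xy; apply: le_trans (fc x y) _.
  apply: (@le_trans _ _ (\sum_(i < n) c i * (e / s))).
    apply: ler_sum => i _; rewrite ler_wpM2l//; apply: le_trans tm.
    apply: dist_agree => // k km; rewrite !iter_left_shift xy// addnC.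
    by rewrite -addSn leq_add// ltnW.
  rewrite -mulr_suml mulrCA ler_piMr ?(ltW e0)//.
  by rewrite ler_pdivrMr// mul1r /s lerDr.
have -> : (\int[mu]_x (expR (f x))%:E)%E = (\int[mu]_x expR (f x))%:E.
  rewrite /Rintegral fineK//; apply: integrable_fin_num => //.
  exact/ucont_integrable/ucont_expR.
rewrite lee_fin; apply: le_trans (exp_moment c0 uf fc) _.
rewrite ler_wpM2l ?expR_ge0// ler_expR ler_wpM2r//.
by apply: sumr_ge0 => i _; rewrite sqr_ge0.
Qed.

End GaussianConcentration.

(** * The dbar distance to the Markov approximations *)

Section MarkovPotential.
Context {R : realType} {A : finType} {a0 : A}.
Local Notation Omega := (Omega a0).
Variable mu : probability Omega R.
Hypotheses (mu_inv : shift_invariant mu) (mu_gt0 : forall s, 0 < prob mu s).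
Local Notation P := (prob mu).

(* The forward conditional probabilities defining [markov_potential] are
   cohomologous to the backward ones, which are normalized. *)
Definition backward_potential m (x : Omega) : R :=
  ln (P (mkseq x m.+1) / P (behead (mkseq x m.+1))).

Lemma backward_potential_concat1 m a x : backward_potential m (concat [:: a] x) =
  ln (P (a :: mkseq x m) / P (mkseq x m)).
Proof. by rewrite /backward_potential mkseq_concat1. Qed.

Lemma backward_potential_normalized m : normalized (backward_potential m).
Proof.
move=> x; under eq_bigr do rewrite backward_potential_concat1 lnK ?posrE ?divr_gt0//.
by rewrite -mulr_suml -(prob_cons mu_inv) divff// gt_eqF.
Qed.

Lemma backward_potential_depends_on m : depends_on m.+1 (backward_potential m).
Proof. by move=> x y /mkseq_agree xy; rewrite /backward_potential xy. Qed.

Lemma word_mkseq n (x : Omega) : word n x = mkseq x n :> seq A.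
Proof. by rewrite /mkseq -val_enum_ord -map_comp. Qed.

(** Both conditional probabilities have the word of length [m.+2] as numerator, and their
    denominators differ by a shift; the potentials differ by the coboundary of [g]. *)
Lemma equilibrium_backward m mu' : equilibrium_state (markov_potential mu m.+2) mu' ->
  equilibrium_state (backward_potential m.+1) mu'.
Proof.
pose g x := ln (P (mkseq x m.+1)).
have ug : ucont (g : Omega -> R) by exact: (ucont_mkseq m.+1 (fun s => ln (P s))).
have ub : ucont (backward_potential m.+1).
  exact/ucont_depends_on/backward_potential_depends_on.
have -> : markov_potential mu m.+2 =
    (fun x => backward_potential m.+1 x + (g (left_shift x) - g x)).
  apply/funext => x.
  rewrite /markov_potential /backward_potential !cylinderE !word_mkseq.
  have E : behead (mkseq x m.+2) = mkseq (left_shift x) m.+1.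
    by rewrite -{1}(concat_left_shift x) mkseq_concat1.
  rewrite -/(prob mu _) -/(prob mu _) E /g !ln_div ?posrE//; ring.
exact: equilibrium_cohomologous.
Qed.

End MarkovPotential.

(** * Coupling the block distributions of two equilibrium states *)

Section DbarBound.
Context {R : realType} {A : finType} {a0 : A}.
Local Notation Omega := (Omega a0).
Local Notation z := ((fun=> a0) : Omega).
Variables (mu nu : probability Omega R) (phi psi : Omega -> R) (m : nat).
Variables (v gamma : nat -> R) (S eps : R).
Hypotheses (phi1 : normalized phi) (psi1 : normalized psi)
  (uphi : ucont phi) (psim : depends_on m.+1 psi)
  (mu_inv : forall f, ucont f -> \int[mu]_x transfer phi f x = \int[mu]_x f x)
  (nu_inv : forall f, ucont f -> \int[nu]_x transfer psi f x = \int[nu]_x f x)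
  (gamma01 : forall k, 0 <= gamma k <= 1)
  (gamma_dec : forall k, gamma k.+1 <= gamma k)
  (gamma_overlap : forall k x y, agree k x y ->
     1 - gamma k <= overlap psi phi x y)
  (eps0 : 0 <= eps) (v0 : forall k, 0 <= v k)
  (gammav : forall k, gamma k <= 1 - expR (- v k) + eps)
  (vS : forall J, \sum_(j < J) v j <= S).

Local Notation kappa := (coupling psi phi).

Let iter_invariant (la : probability Omega R) chi n f :
  ucont chi -> ucont f ->
  (forall f, ucont f -> \int[la]_x transfer chi f x = \int[la]_x f x) ->
  \int[la]_x iter n (transfer chi) f x = \int[la]_x f x.
Proof.
move=> uchi uf inv; elim: n => [//|n IH] /=.
by rewrite inv//; exact: ucont_transfer_iter.
Qed.

Section Blocks.
Variable N : nat.

Let at_word (a : N.-tuple A) (x : Omega) : R := (word N x == a)%:R.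

Let sum_at_word x (F : N.-tuple A -> R) : \sum_(a : N.-tuple A) F a * at_word a x =
  F (word N x).
Proof.
rewrite (bigD1 (word N x))//= /at_word eqxx mulr1 big1 ?addr0// => a.
by rewrite eq_sym => /negbTE ->; rewrite mulr0.
Qed.

Let at_word_ge0 a x : 0 <= at_word a x.
Proof. exact: ler0n. Qed.

Let at_word_depends_on a : depends_on N (at_word a).
Proof. by move=> x y /word_agree xy; rewrite /at_word xy. Qed.

Let ucont_at_word a : ucont (at_word a).
Proof. exact/ucont_depends_on/at_word_depends_on. Qed.

Let Rint_at_word (la : probability Omega R) a :
  \int[la]_x at_word a x = fine (la (cylinder a)).
Proof.
rewrite cylinderE -/(prob la a) -Rint_cyl; apply: eq_Rintegral => x _.
by rewrite /at_word -val_eqE /= size_tuple word_mkseq.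
Qed.

(** The two chains start independently from [nu] and [mu] and make [N] coupled steps. The [nu]-point
    is kept only through its first [m] letters, completed by [z]; the left marginal is still exact
    because [psi] reads [m.+1] coordinates. *)
Let block_coupling (a b : N.-tuple A) : R :=
  \sum_(s : m.-tuple A) prob nu s *
    \int[mu]_y iter N kappa (fun x y => at_word a x * at_word b y) (concat s z) y.

Let ucont_iter F x : (forall u, ucont (F u)) -> ucont (iter N kappa F x).
Proof. by move=> uF; exact: ucont_coupling_iter. Qed.

Let coupling_iter_ge0 F : (forall x y, 0 <= F x y) ->
  forall x y, 0 <= iter N kappa F x y.
Proof.
move=> F0; elim: N => [//|n IH] x y /=.
rewrite -(coupling_cst psi1 phi1 0 x y); exact: coupling_le.
Qed.

Let ucont_at_words a b u : ucont (fun y => at_word a u * at_word b y).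
Proof. by apply: ucontM => //; exact: ucont_cst. Qed.

Lemma block_couplingP : is_coupling nu mu block_coupling.
Proof.
split=> [a b|a|b].
- apply: sumr_ge0 => s _; apply: mulr_ge0; first exact: prob_ge0.
  by apply: Rintegral_ge0 => y _; apply: coupling_iter_ge0 => *; rewrite mulr_ge0.
- rewrite exchange_big -Rint_at_word -(iter_invariant N _ _ nu_inv)//; last first.
    exact/ucont_depends_on/psim.
  rewrite (@Rint_depends_on _ _ _ nu m _ z); last first.
    apply: depends_on_transfer_iter => // x y xy.
    by apply: at_word_depends_on; apply: agree_le xy; exact: leq_addl.
  apply: eq_bigr => s _; rewrite -mulr_sumr; congr (_ * _).
  rewrite -Rint_sum => [|b _]; last by apply: ucont_iter; exact: ucont_at_words.
  rewrite -[RHS](Rint_cst mu); apply: eq_Rintegral => y _ /=.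
  rewrite -(coupling_iter_left psi1 phi1 _ _ _ y) -coupling_iter_sum.
  congr (iter N kappa _ _ _); apply/funext => u; apply/funext => t.
  by rewrite (sum_at_word t (fun=> at_word a u)).
- rewrite exchange_big -Rint_at_word -(iter_invariant N _ _ mu_inv)//.
  rewrite -[RHS]mul1r -(wsum_prob nu m) mulr_suml.
  apply: eq_bigr => s _; rewrite -mulr_sumr; congr (_ * _).
  rewrite -Rint_sum => [|a _]; last by apply: ucont_iter; exact: ucont_at_words.
  apply: eq_Rintegral => y _ /=.
  rewrite -(coupling_iter_right phi psi1 _ _ (concat s z) y) -coupling_iter_sum.
  congr (iter N kappa _ _ _); apply/funext => u; apply/funext => t.
  under eq_bigr do rewrite mulrC.
  by rewrite (sum_at_word u (fun=> at_word b t)).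
Qed.

Let mismatches (x y : Omega) : R :=
  \sum_(i < N) discrepancy (iter i left_shift x) (iter i left_shift y).

Let mismatchesE x y : \sum_(a : N.-tuple A) \sum_(b : N.-tuple A)
  (hamming a b)%:R * (at_word a x * at_word b y) = mismatches x y.
Proof.
under eq_bigr => a _.
  under eq_bigr do rewrite mulrA.
  rewrite (sum_at_word y (fun b => (hamming a b)%:R * at_word a x)).
  over.
rewrite (sum_at_word x (fun a => (hamming a (word N y))%:R)).
rewrite /hamming natr_sum; apply: eq_bigr => i _.
by rewrite !tnth_mktuple /discrepancy !iter_left_shift !add0n.
Qed.

(** Letter [i] was prepended at step [N - i], so it costs at most [renewal gamma (N - i) 0]; the
    argument 0 allows arbitrary starting points. *)
Let iter_mismatches_le x y :
  iter N kappa mismatches x y <= expR S * (1 + N.+1%:R * eps).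
Proof.
apply: (@le_trans _ _ (\sum_(k < N.+1) renewal gamma k 0)); last first.
  apply: renewal_sum0_bound => // k; first by case/andP: (gamma01 k).
  by case/andP: (gamma01 k).
rewrite /mismatches coupling_iter_sum.
apply: (@le_trans _ _ (\sum_(i < N) renewal gamma (N - i) 0)).
  apply: ler_sum => i _.
  rewrite (coupling_iter_shifts psi1 phi1 (@discrepancy R A a0)) ?(ltnW (ltn_ord i))//.
  exact: (coupling_iter_discrepancy psi1 phi1 gamma01).
rewrite [leLHS](reindex_inj rev_ord_inj) big_ord_recl /=.
rewrite -[leLHS]add0r; apply: lerD; first exact: ler0n.
rewrite le_eqVlt; apply/orP; left; apply/eqP; apply: eq_bigr => i _.
by rewrite subKn ?add1n//; exact: ltn_ord.
Qed.

Lemma block_coupling_cost :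
  \sum_(a : N.-tuple A) \sum_(b : N.-tuple A) (hamming a b)%:R * block_coupling a b <=
  expR S * (1 + N.+1%:R * eps).
Proof.
rewrite [leLHS](_ : _ = \sum_(s : m.-tuple A) prob nu s *
    \int[mu]_y iter N kappa mismatches (concat s z) y).
  rewrite -[leRHS]mul1r -{1}(wsum_prob nu m) mulr_suml; apply: ler_sum => s _.
  apply: ler_wpM2l; first exact: prob_ge0.
  rewrite -[leRHS](Rint_cst mu); apply: le_Rint => [||y].
  - apply: ucont_iter => u; apply: ucont_sum => i _.
    apply: (@ucont_depends_on _ _ _ i.+1) => x y xy; congr ((_ != _)%:R).
    by rewrite !iter_left_shift add0n xy.
  - exact: ucont_cst.
  - exact: iter_mismatches_le.
under eq_bigr do under eq_bigr do rewrite mulr_sumr.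
under eq_bigr do rewrite exchange_big.
rewrite exchange_big; apply: eq_bigr => s _.
under eq_bigr do under eq_bigr do rewrite mulrCA.
under eq_bigr do rewrite -mulr_sumr.
rewrite -mulr_sumr; congr (_ * _).
under eq_bigr => a _.
  under eq_bigr => b _.
    rewrite -RintZ; last by apply: ucont_iter; exact: ucont_at_words.
    over.
  rewrite -Rint_sum => [|b _]; last first.
    apply: ucontM; first exact: ucont_cst.
    by apply: ucont_iter; exact: ucont_at_words.
  over.
rewrite -Rint_sum => [|a _]; last first.
  apply: ucont_sum => b _; apply: ucontM; first exact: ucont_cst.
  by apply: ucont_iter; exact: ucont_at_words.
apply: eq_Rintegral => y _.
under eq_bigr do under eq_bigr do rewrite -coupling_iterZ.
under eq_bigr do rewrite -coupling_iter_sum.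
rewrite -coupling_iter_sum; congr (iter N kappa _ _ _).
by apply/funext => u; apply/funext => t; exact: mismatchesE.
Qed.

Lemma dbar_n_le : dbar_n N nu mu <= expR S * (1 + N.+1%:R * eps).
Proof.
apply: le_trans block_coupling_cost; apply: inf_lbound.
  exists 0 => _ [Q [Q0 _ _] ->].
  by apply: sumr_ge0 => a _; apply: sumr_ge0 => b _; rewrite mulr_ge0.
by exists block_coupling => //; exact: block_couplingP.
Qed.

End Blocks.

(* A divergent [lim] is [0], so the existence of the limit is not needed. *)
Lemma dbar_le : dbar nu mu <= expR S * eps.
Proof.
have [cv|/dvgP] := pselect (cvgn (fun n => dbar_n n nu mu / n%:R)); last first.
  by rewrite /dbar => ->; rewrite mulr_ge0 ?expR_ge0.
apply/ler_addgt0Pr => e e0; apply: limr_le => //.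
(* The part of the bound on [dbar_n] that does not grow with [n]; it is absorbed by [e * n]. *)
pose c := expR S * (1 + eps).
exists (Num.truncn (c / e)).+1 => // n /= cn.
have n0 : (0 < n%:R :> R) by rewrite ltr0n (leq_ltn_trans _ cn).
have cen : c < e * n%:R.
  rewrite -ltr_pdivrMl// mulrC; apply: lt_le_trans (truncnS_gt _) _.
  by rewrite ler_nat.
rewrite ler_pdivrMr//; apply: le_trans (dbar_n_le n) _.
rewrite -natr1; move: cen; rewrite /c; nra.
Qed.

End DbarBound.

(** * Summability of the regularity classes *)

Section SummableRates.
Context {R : realType}.
Implicit Types (w b : nat -> R).

Definition bounded_sums w : Prop := exists S, forall J, \sum_(j < J) w j <= S.

Lemma bounded_sums_eventually w b c N : (forall n, 0 <= b n) -> 0 <= c ->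
  (forall n, (N <= n)%N -> w n <= c * b n) -> bounded_sums b -> bounded_sums w.
Proof.
move=> b0 c0 wb [S bS]; exists (\sum_(j < N) `|w j| + c * S) => J.
apply: (@le_trans _ _ (\sum_(j < N + J) (if (j < N)%N then `|w j| else c * b j))).
  apply: (@le_trans _ _ (\sum_(j < J) (if (j < N)%N then `|w j| else c * b j))).
    apply: ler_sum => j _; case: ltnP => jN; first exact: ler_norm.
    exact: wb.
  rewrite -!(big_mkord predT (fun j => if (j < N)%N then `|w j| else c * b j)).
  rewrite [leRHS](big_cat_nat (n := J))//= ?leq_addl// lerDl sumr_ge0// => j _.
  by case: ifP => _; rewrite // mulr_ge0.
rewrite big_split_ord /=; apply: lerD.
  by apply: ler_sum => j _; rewrite ltn_ord.
under eq_bigr do rewrite ltnNge leq_addr /=.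
rewrite -mulr_sumr ler_wpM2l//; apply: le_trans (bS (N + J)%N).
by rewrite [leRHS]big_split_ord /= lerDr sumr_ge0.
Qed.

Lemma bounded_sums_geometric (t : R) : 0 < t < 1 -> bounded_sums (fun n => t ^+ n).
Proof.
move=> /andP[t0 t1]; exists (1 - t)^-1 => J.
have t1' : 0 < 1 - t by rewrite subr_gt0.
rewrite -[leRHS]mul1r ler_pdivlMr//.
have := subrX1 t J; have : 0 <= t ^+ J by rewrite exprn_ge0// ltW.
lra.
Qed.

(** The integral test in telescoping form: a term is at most a difference of consecutive powers with
    exponent [1 - a], divided by [a - 1]. *)
Lemma bounded_sums_powR (a : R) : 1 < a ->
  bounded_sums (fun n => n%:R `^ (- a)).
Proof.
move=> a1; pose d := a - 1; have d0 : 0 < d by rewrite subr_gt0.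
have step n : (n.+2%:R : R) `^ (- a) <=
    d^-1 * (n.+1%:R `^ (- d) - n.+2%:R `^ (- d)).
  rewrite mulrC ler_pdivlMr// /powR !pnatr_eq0 /=.
  set l := ln n.+1%:R; set l' := ln n.+2%:R.
  have h : expR (- l') <= l' - l.
    have -> : expR (- l') = n.+2%:R^-1 by rewrite expRN lnK// posrE ltr0n.
    rewrite /l' /l -ln_div ?posrE ?ltr0n//.
    rewrite -lerN2 -lnV ?posrE ?divr_gt0 ?ltr0n// invf_div.
    rewrite -ler_expR lnK ?posrE ?divr_gt0 ?ltr0n//.
    apply: le_trans (expR_ge1Dx _).
    rewrite -(natr1 n.+1); have : 0 < n.+1%:R :> R by rewrite ltr0n.
    set p := n.+1%:R => p0.
    rewrite le_eqVlt; apply/orP; left; apply/eqP; field; apply: lt0r_neq0; lra.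
  have E : expR (- d * l) = expR (- d * l') * expR (d * (l' - l)).
    by rewrite -expRD; congr expR; ring.
  have -> : expR (- a * l') = expR (- d * l') * expR (- l').
    by rewrite -expRD; congr expR; rewrite /d; ring.
  rewrite E -[X in _ <= _ - X]mulr1 -mulrBr -mulrA ler_wpM2l ?expR_ge0//.
  have := expR_ge1Dx (d * (l' - l)).
  have : expR (- l') * d <= (l' - l) * d by rewrite ler_wpM2r// ltW.
  lra.
exists (0 `^ (- a) + 1 `^ (- a) + d^-1) => -[|[|J]].
- by rewrite big_ord0 !addr_ge0 ?powR_ge0// invr_ge0 ltW.
- rewrite big_ord_recl big_ord0 addr0 -addrA lerDl.
  by rewrite addr_ge0 ?powR_ge0// invr_ge0 ltW.
rewrite !big_ord_recl addrA lerD2l /=.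
apply: (@le_trans _ _ (d^-1 * \sum_(j < J)
    (j.+1%:R `^ (- d) - j.+2%:R `^ (- d)))).
  by rewrite mulr_sumr; apply: ler_sum => j _; exact: step.
rewrite ler_piMr ?invr_ge0 ?(ltW d0)//.
rewrite -(big_mkord predT (fun j => j.+1%:R `^ (- d) - j.+2%:R `^ (- d))).
under eq_bigr do rewrite -opprB.
rewrite sumrN telescope_sumr// opprB powR1 gerBl; exact: powR_ge0.
Qed.

Lemma bounded_sums_bigO w b : (forall n, 0 <= b n) -> w =O_\oo b ->
  bounded_sums b -> bounded_sums w.
Proof.
move=> b0 /eqOP wb; have [c [c0 [N _ cw]]] : exists c, 0 <= c /\
    \forall n \near \oo, `|w n| <= c * `|b n|.
  near (pinfty_nbhs R) => c; exists c; split; last by near: c.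
  by near: c; exact: nbhs_pinfty_ge.
apply: (@bounded_sums_eventually w b c N) => // n Nn.
have := cw n Nn; rewrite /= (ger0_norm (b0 n)).
exact: le_trans (ler_norm _).
Unshelve. all: by end_near.
Qed.

Lemma ln_natr_ge (M : R) : exists N, forall n, (N <= n)%N -> M <= ln n%:R.
Proof.
exists (Num.truncn (expR M)).+1 => n Nn.
have Mn : expR M <= n%:R.
  by apply: le_trans (ltW (truncnS_gt _)) _; rewrite ler_nat.
by rewrite -ler_expR lnK// posrE (lt_le_trans (expR_gt0 M)).
Qed.

(** Comparison with the series of inverse squares, whose terms are [expR (- 2 * ln n)]. *)
Lemma bounded_sums_of_exponent (g : nat -> R) (M : R) :
  (forall n : nat, M <= ln n%:R -> 2 * ln n%:R <= g n) ->
  bounded_sums (fun n => expR (- g n)).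
Proof.
move=> hg; have [N hN] := ln_natr_ge M.
have : bounded_sums (fun n => n%:R `^ (- 2) : R) by apply: bounded_sums_powR; lra.
apply: (@bounded_sums_eventually _ _ 1 N.+1) => // n Nn.
rewrite mul1r /powR pnatr_eq0; case: n Nn => [//|n] Nn /=.
rewrite ler_expR mulNr lerN2; apply: hg; apply: hN; exact: ltnW.
Qed.

Lemma bounded_sums_log (eta a : R) : 0 < eta < 1 -> 1 < a ->
  bounded_sums (fun n => eta `^ (ln n%:R `^ a)).
Proof.
move=> /andP[eta0 eta1] a1.
have k0 : 0 < - ln eta.
  by rewrite oppr_gt0 -expR_lt1 lnK.
(* [M] is chosen so that [M <= ln n] forces the power [a - 1] of [ln n] to be at least [2 / k]. *)
pose k := - ln eta; pose M := (2 / k) `^ (a - 1)^-1.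
have -> : (fun n => eta `^ (ln n%:R `^ a)) =
    (fun n => expR (- (ln n%:R `^ a * k))) :> (nat -> R).
  by apply/funext => n; rewrite {1}/powR gt_eqF// /k mulrN opprK.
apply: (@bounded_sums_of_exponent _ M) => n Mn.
have k2 : 0 < 2 / k by rewrite divr_gt0.
have M0 : 0 < M by rewrite powR_gt0.
have l0 : 0 < ln n%:R :> R by exact: lt_le_trans Mn.
set l := ln _ in Mn l0 *.
have -> : l `^ a = l * l `^ (a - 1).
  rewrite -{2}[l]powRr1 ?(ltW l0)// -powRD; first by rewrite [1 + _]addrC subrK.
  by rewrite (gt_eqF l0) implybT.
rewrite mulrC -mulrA ler_wpM2l ?(ltW l0)// -ler_pdivrMr//.
have -> : 2 / k = M `^ (a - 1).
  by rewrite -powRrM mulVf ?powRr1 ?(ltW k2)// subr_eq0 gt_eqF.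
by apply: ge0_ler_powR => //; rewrite ?nnegrE ?subr_ge0 ltW.
Qed.

Lemma bounded_sums_stretched (c a : R) : 0 < c -> 0 < a ->
  bounded_sums (fun n => expR (- (c * n%:R `^ a))).
Proof.
(* With [l = ln n], [expR (a * l)] is at least [(a * l / 2) ^+ 2], and [c] times this is at least
   [2 * l] once [l] reaches [8 / (c * a ^+ 2)]. The 1 in the maximum excludes [n = 0], where [ln] is
   0 by default. *)
move=> c0 a0; apply: (@bounded_sums_of_exponent _ (Num.max 1 (8 / (c * a ^+ 2)))).
move=> n; rewrite ge_max => /andP[l1 lM].
have n0 : n%:R != 0 :> R.
  by apply: contraTneq l1 => ->; rewrite ln0// -ltNge.
rewrite /powR (negbTE n0); set l := ln _ in l1 lM *.
have : expR (a * l / 2) * expR (a * l / 2) = expR (a * l).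
  by rewrite -expRD -splitr.
have := expR_ge1Dx (a * l / 2); have al : 0 <= a * l by rewrite mulr_ge0 ?ltW//; lra.
set E := expR (a * l / 2) => hE <-.
rewrite ler_pdivrMr ?mulr_gt0 ?exprn_gt0// in lM.
have : (a * l / 2) ^+ 2 <= E * E.
  by rewrite expr2; apply: ler_pM; rewrite ?divr_ge0//; lra.
move=> h; apply: (@le_trans _ _ (c * (a * l / 2) ^+ 2)); last by rewrite ler_wpM2l// ltW.
have -> : c * (a * l / 2) ^+ 2 = (l * (c * a ^+ 2)) / 4 * l by field.
rewrite ler_wpM2r//; lra.
Qed.

End SummableRates.

(** * Walters' condition as a modulus of continuity, and the final estimates *)

Section WaltersPotentials.
Context {R : realType} {A : finType} {a0 : A}.
Local Notation Omega := (Omega a0).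
Variable phi : Omega -> R.
Hypothesis phi_walters : walters phi.
Local Notation w := (fun n : nat => fine (Wp n phi)).

Lemma Wp_EFin n : Wp n phi = (w n)%:E.
Proof.
case: phi_walters => Wfin Wpos _ _; rewrite fineK// ge0_fin_numE ?ltW//.
apply: le_lt_trans Wfin; apply: ge_ereal_sup => _ [x [y [_ ->]]].
by apply: ereal_sup_ubound; exists x, y.
Qed.

Lemma Wp_fine_ge0 n : 0 <= w n.
Proof. by case: phi_walters => _ Wpos _ _; rewrite fine_ge0// ltW. Qed.

Lemma Wp_fine_le n : w n.+1 <= w n.
Proof.
by case: phi_walters => _ _ Wdec _; rewrite -lee_fin -!Wp_EFin; exact: Wdec.
Qed.

Lemma potential_osc k a (x y : Omega) : agree k x y ->
  `|phi (concat [:: a] x) - phi (concat [:: a] y)| <= w k.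
Proof.
move=> xy; rewrite -lee_fin -Wp_EFin; apply: (@le_trans _ _ (W phi x y)).
  apply: ereal_sup_ubound; exists 1%N, [tuple a].
  by rewrite /birkhoff_sum !big_ord_recl !big_ord0 !addr0.
by apply: ereal_sup_ubound; exists x, y; split=> //; exact/word_agree.
Qed.

Lemma potential_oscS k (x y : Omega) : agree k.+1 x y -> `|phi x - phi y| <= w k.
Proof.
move=> /agreeS[xy0 xy]; rewrite -(concat_left_shift x) -(concat_left_shift y) xy0.
exact: potential_osc.
Qed.

Lemma walters_ucont : ucont phi.
Proof.
move=> e e0; case: phi_walters => _ _ _ /fine_cvgP[_ /cvgrPdist_le/(_ e e0)].
move=> [N _ /(_ N (leqnn N)) wN]; exists N.+1 => x y /potential_oscS h.
apply: le_trans h _; move: wN; rewrite /= sub0r normrN.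
exact: le_trans (ler_norm _).
Qed.

Let var_set n := [set r | exists x y : Omega,
  word n x = word n y /\ r = `|phi x - phi y|].

Let var_set_ubound n : has_ubound (var_set n.+1).
Proof.
by exists (w n) => _ [x [y [/word_agree xy ->]]]; exact: potential_oscS.
Qed.

(** A real supremum is an upper bound only for a bounded set; one common letter ensures this through
    [Wp], hence the index [n.+1]. *)
Lemma le_var n (x y : Omega) : agree n.+1 x y -> `|phi x - phi y| <= var n.+1 phi.
Proof.
move=> /word_agree xy; apply: sup_upper_bound; last by exists x, y.
split; last exact: var_set_ubound.
by exists `|phi x - phi y|, x, y.
Qed.

Lemma var_ge0 n : 0 <= var n.+1 phi.
Proof.
by apply: le_trans (le_var (x := fun=> a0) (y := fun=> a0) _).
Qed.

End WaltersPotentials.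

Lemma admissible_bounded_sums (R : realType) (A : finType) (a0 : A) (theta : R)
  (phi : Omega a0 -> R) : 0 < theta < 1 -> admissible theta phi ->
  bounded_sums (fun n => fine (Wp n phi)).
Proof.
move=> theta01 [_ _ [w|[a a1 w]|[eta [a [eta01 a1 w]]]|[c [a [c0 /andP[a_gt0 _] w]]]]].
- apply: bounded_sums_bigO w _ => [n|]; last exact: bounded_sums_geometric.
  by case/andP: theta01 => /ltW t0 _; rewrite exprn_ge0.
- apply: bounded_sums_bigO w _ => [n|]; last exact: bounded_sums_powR.
  exact: powR_ge0.
- apply: bounded_sums_bigO w _ => [n|]; last exact: bounded_sums_log.
  exact: powR_ge0.
- apply: bounded_sums_bigO w _ => [n|]; last exact: bounded_sums_stretched.
  exact: expR_ge0.
Qed.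

Lemma dbar_markov_le (R : realType) (A : finType) (a0 : A) (phi : Omega a0 -> R)
    (mu nu : probability (Omega a0) R) (S : R) (m : nat) :
  normalized phi -> walters phi -> equilibrium_state phi mu ->
  (forall J, \sum_(j < J) fine (Wp j phi) <= S) ->
  equilibrium_state (markov_potential mu m.+2) nu ->
  dbar nu mu <= expR S * var m.+2 phi.
Proof.
move=> phi1 phiW mu_eq wS nu_eq.
have uphi := walters_ucont phiW.
have mu_inv := mu_eq.1.
have F0 := equilibrium_pressure_ge0 phi1 uphi mu_eq.
have mu_gt0 := prob_gt0 mu_inv phi1 uphi F0.
pose psi := backward_potential mu m.+1.
have psi1 : normalized psi by exact: backward_potential_normalized.
have psim : depends_on m.+2 psi by exact: backward_potential_depends_on.
have upsi : ucont psi by exact: ucont_depends_on psim.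
have {}nu_eq : equilibrium_state psi nu by exact: equilibrium_backward.
pose w n := fine (Wp n phi); pose e := var m.+2 phi.
have e0 : 0 <= e by exact: var_ge0.
have w0 n : 0 <= w n by exact: Wp_fine_ge0.
(* [psi] at [a x] is the logarithm of a mean of [expR (phi (a t))] over points [t] sharing [m.+1]
   letters with [x]. If [k <= m.+1], then [t] and [y] share [k] letters and [w k] bounds the
   difference; otherwise [a t] and [a y] share [m.+2] letters and [e] does. *)
pose gamma k := 1 - expR (- Num.max (w k) e).
have max0 k : 0 <= Num.max (w k) e by rewrite le_max w0.
apply: (@dbar_le _ _ _ mu nu phi psi m.+1 w gamma S e) => //.
- by apply: transfer_invariant.
- by apply: transfer_invariant => //; [exact: nu_eq.1|exact: equilibrium_pressure_ge0].
- by move=> k; rewrite subr_ge0 -{1}expR0 ler_expR oppr_le0 max0 /= gerBl expR_ge0.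
- move=> k; rewrite lerD2l lerN2 ler_expR lerN2 ge_max le_max Wp_fine_le//=.
  by rewrite le_max lexx orbT.
- move=> k x y xy; rewrite subKr; apply: overlap_ge => [|a].
    by rewrite -expR0 ler_expR oppr_le0.
  rewrite ler_expR lerNl opprB lerBlDl.
  rewrite /psi backward_potential_concat1 -ler_expR lnK ?posrE ?divr_gt0//.
  rewrite ler_pdivrMr//; apply: (prob_cons_upper mu_inv phi1 uphi F0) => t xt.
  rewrite ler_expR -lerBlDl; apply: le_trans (ler_norm _) _; rewrite le_max.
  have {}xt : agree m.+1 t x.
    by apply/mkseq_agree; move: xt; rewrite /cyl /set_of /= size_map size_iota.
  have [km|mk] := leqP k m.+1.
    apply/orP; left; apply: potential_osc => //.
    by apply: agree_trans xy; exact: agree_le xt.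
  apply/orP; right; apply: le_var => //; apply/agree_concat1.
  by apply: agree_trans xt _; apply: agree_le xy; exact: ltnW.
(* The maximum is at most [w k + e], and [expR (- e) >= 1 - e] turns the excess into an additive
   [e]. *)
- move=> k; have : expR (- w k) * (1 - e) <= expR (- Num.max (w k) e).
    apply: (@le_trans _ _ (expR (- w k) * expR (- e))).
      by rewrite ler_wpM2l ?expR_ge0// expR_ge1Dx.
    rewrite -expRD ler_expR -opprD lerN2 ge_max lerDl e0 lerDr; exact: w0.
  have : expR (- w k) <= 1 by rewrite -expR0 ler_expR oppr_le0.
  rewrite /gamma; nra.
Qed.

Theorem corollary3p10 (R : realType) (A : finType) (a0 : A) (theta : R)
  (theta01 : 0 < theta < 1)
  (phi : Omega a0 -> R) (mu : probability (Omega a0) R)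
  (phi_adm : admissible theta phi) (phi_norm : normalized phi)
  (mu_eq : equilibrium_state phi mu) :
  exists (C : R) (n_phi : nat),
    [/\ 0 < C, gaussian_concentration theta mu C, (1 <= n_phi)%N &
        forall n : nat, (n_phi <= n)%N ->
        forall mu_n : probability (Omega a0) R,
          equilibrium_state (markov_potential mu n) mu_n ->
          dbar mu_n mu <= rho phi C * var n phi].
Proof.
have phiW : walters phi by case: phi_adm.
have uphi := walters_ucont phiW.
have [S wS] := admissible_bounded_sums theta01 phi_adm.
pose B := expR S / (1 - theta).
have B0 : 0 < B.
  by case/andP: theta01 => _ th1; rewrite divr_gt0 ?expR_gt0// subr_gt0.
pose E := (expR 1 - 1) * expR (3 / 2 * sup_norm phi).
have E0 : 0 < E by rewrite mulr_gt0 ?expR_gt0// subr_gt0 expR_gt1.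
(* The first summand gives concentration; the second makes [rho phi C] at least [expR S], since the
   alphabet has at least one letter. *)
pose C := 2 * B ^+ 2 + (expR S / E) ^+ 2.
have C0 : 0 < C.
  by apply: ltr_pwDl; [rewrite mulr_gt0// exprn_gt0|exact: sqr_ge0].
have rhoS : expR S <= rho phi C.
  rewrite /rho -mulrA -/E -ler_pdivrMr//.
  have D0 : 0 <= expR S / E by rewrite divr_ge0 ?expR_ge0// ltW.
  rewrite -[leLHS]ger0_norm// -sqrtr_sqr; apply: ler_wsqrtr.
  have A1 : 1 <= #|A|%:R :> R by rewrite ler1n; apply/card_gt0P; exists a0.
  have CD : (expR S / E) ^+ 2 <= C.
    by rewrite lerDr; apply: mulr_ge0 => //; exact: sqr_ge0.
  nra.
have F0 := equilibrium_pressure_ge0 phi_norm uphi mu_eq.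
(* From [n = 2] on, [markov_potential] is the logarithm of a conditional probability and has a
   backward form. *)
exists C, 2%N; split=> //.
  apply: (@gaussian_concentration_holds _ _ _ mu phi (fun j => fine (Wp j phi)) S) => //.
  - exact: transfer_invariant mu_eq.1 phi_norm uphi F0.
  - exact: Wp_fine_ge0.
  - exact: Wp_fine_le.
  - exact: potential_osc.
  - by rewrite lerDl sqr_ge0.
move=> [|[|m]]// _ nu nu_eq.
apply: le_trans (dbar_markov_le phi_norm phiW mu_eq wS nu_eq) _.
by rewrite ler_wpM2r// var_ge0.
Qed.
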